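(* Let $G$ be a compact Lie group and let $\tau$ be a non-trivial irreducible (finite-dimensional complex) representation of $G$ whose character $\chi^{\tau}$ is real valued. Fix a non-identity element $\alpha\in G$ such that $\alpha$ and $\alpha^{-1}$ are conjugate in $G$, set $a=1-\frac{\chi^{\tau}(\alpha)}{\dim(\tau)}$, and assume $a\neq 0$. Let $W=\chi^{\tau}(g)$ where $g$ is chosen from the Haar measure of $G$. Then for all real $x_0$, $$\left| \mathbb{P}(W \leq x_0) - \frac{1}{\sqrt{2 \pi}} \int_{-\infty}^{x_0} e^{-\frac{x^2}{2}}\, dx \right| \leq \sqrt{\sum_{\phi\neq 1} m_{\phi}(\tau^2)^2 \left[ 2 - \frac{1}{a} \left(1 - \frac{\chi^{\phi}(\alpha)}{\dim(\phi)} \right) \right]^2} + \left[ \frac{1}{\pi} \sum_{\phi} m_{\phi}(\tau^2)^2 \left(8 - \frac{6}{a} \left(1-\frac{\chi^{\phi}(\alpha)}{\dim(\phi)} \right) \right) \right]^{1/4},$$ where the first sum is over all non-trivial irreducible representations $\phi$ of $G$, and the second sum is over all irreducible representations $\phi$ of $G$.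
   Context: Haar measure is normalized to be a probability measure. For an irreducible representation $\phi$ of $G$, $\chi^{\phi}$ denotes its character and $\dim(\phi)$ its dimension; sums over irreducible representations are over isomorphism classes. $m_{\phi}(\tau^r)$ denotes the multiplicity of $\phi$ in the $r$-fold tensor product of $\tau$ (which has character $(\chi^{\tau})^r$). Since $\alpha$ is conjugate to $\alpha^{-1}$, all $\chi^{\phi}(\alpha)$ are real. *)

(* Defs.v *)
From HB Require Import structures.
From mathcomp Require Import all_boot all_order all_algebra.
From mathcomp Require Import all_classical all_reals all_analysis.
From mathcomp Require Import complex mxtens generic_quotient.

Set Implicit Arguments.
Unset Strict Implicit.
Unset Printing Implicit Defensive.

Import Order.TTheory GRing.Theory Num.Theory.
Import numFieldNormedType.Exports.
Local Open Scope classical_set_scope.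
Local Open Scope ring_scope.

(* C^k on U through iterated partial derivatives. Only meant for open U. *)
Fixpoint Ck_on (R : realType) (n k : nat) (U : set 'rV[R]_n)
    (f : 'rV[R]_n -> R) : Prop :=
  {in U, continuous f} /\
  match k with
  | 0%N => True
  | k'.+1 => forall i : 'I_n,
      (forall x, U x -> derivable f x (delta_mx 0 i)) /\
      Ck_on k' U (fun x => 'D_(delta_mx 0 i) f x)
  end.

Definition smooth_on (R : realType) (n m : nat) (U : set 'rV[R]_n)
    (f : 'rV[R]_n -> 'rV[R]_m) : Prop :=
  forall (k : nat) (j : 'I_m), Ck_on k U (fun x => f x 0 j).

(* The values of [chart_fun] outside [chart_dom], and of [chart_inv] outside
   the image of [chart_dom], are irrelevant. *)
Record chart (R : realType) (T : topologicalType) (n : nat) := Chart {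
  chart_dom : set T ;
  chart_fun :> T -> 'rV[R]_n ;
  chart_inv : 'rV[R]_n -> T ;
  chart_dom_open : open chart_dom ;
  chart_img_open : open (chart_fun @` chart_dom) ;
  chart_funK : forall x, chart_dom x -> chart_inv (chart_fun x) = x ;
  chart_fun_cts : {in chart_dom, continuous chart_fun} ;
  chart_inv_cts : {in chart_fun @` chart_dom, continuous chart_inv} }.

Definition chart_img (R : realType) (T : topologicalType) (n : nat)
  (c : chart R T n) : set 'rV[R]_n := c @` chart_dom c.

HB.mixin Record isTopologicalGroup G & PointedTopological G & Group G := {
  mulg_continuous : continuous (fun x : G * G => (x.1 * x.2)%g) ;
  invg_continuous : continuous (fun x : G => (x^-1)%g) }.

(* Pointedness is only needed for the library's Borel sigma-algebra; any group
   is pointed by its unit. *)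
#[short(type="topologicalGroupType")]
HB.structure Definition TopologicalGroup :=
  {G of PointedTopological G & Group G & isTopologicalGroup G}.

HB.mixin Record TopologicalGroup_isLieGroup (R : realType) G
    & TopologicalGroup G := {
  lie_dim : nat ;
  lie_atlas : set (chart R G lie_dim) ;
  lie_hausdorff : hausdorff_space G ;
  lie_second_countable : @second_countable G ;
  lie_atlas_cover : forall x : G, exists2 c, lie_atlas c & chart_dom c x ;
  lie_atlas_smooth : forall c c', lie_atlas c -> lie_atlas c' ->
    smooth_on (c @` (chart_dom c `&` chart_dom c')) (c' \o chart_inv c) ;
  (* in charts c1 x c2 on the source, R^n x R^n being 'rV_(n + n) *)
  lie_mulg_smooth : forall c1 c2 c,
    lie_atlas c1 -> lie_atlas c2 -> lie_atlas c ->
    smooth_on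
      [set z : 'rV[R]_(lie_dim + lie_dim) |
        [/\ chart_img c1 (lsubmx z), chart_img c2 (rsubmx z) &
            chart_dom c (chart_inv c1 (lsubmx z) *
                         chart_inv c2 (rsubmx z))%g]]
      (fun z => c (chart_inv c1 (lsubmx z) * chart_inv c2 (rsubmx z))%g) ;
  lie_invg_smooth : forall c1 c, lie_atlas c1 -> lie_atlas c ->
    smooth_on
      [set z | chart_img c1 z /\ chart_dom c ((chart_inv c1 z)^-1)%g]
      (fun z => c ((chart_inv c1 z)^-1)%g) }.

#[short(type="lieGroupType")]
HB.structure Definition LieGroup (R : realType) :=
  {G of TopologicalGroup G & TopologicalGroup_isLieGroup R G}.

Definition borelType (T : ptopologicalType) := g_sigma_algebraType (@open T).

(* Left-invariant Borel probability measure. Regularity is not required: it is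
   automatic on a compact Lie group, which is compact and second countable. *)
Definition is_haar (R : realType) (G : topologicalGroupType)
    (mu : probability (borelType G) R) : Prop :=
  forall (g : G) (A : set (borelType G)), measurable A ->
    mu ((fun x : G => (g * x)%g) @` A) = mu A.

(* Continuity of a C-valued map, C = R^2 having the product topology. *)
Definition ccontinuous (R : realType) (T : topologicalType) (f : T -> R[i]) :=
  continuous (fun x => complex.Re (f x)) /\
  continuous (fun x => complex.Im (f x)).

Section Ccontinuous.
Context {R : realType} {T : topologicalType}.
Implicit Types f g : T -> R[i].

Lemma ccontinuous_cst (z : R[i]) : ccontinuous (fun _ : T => z).
Proof. by split=> x; apply: cvg_cst. Qed.

Lemma ccontinuousM f g : ccontinuous f -> ccontinuous g ->
  ccontinuous (fun x => f x * g x).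
Proof.
move=> [fr fi] [gr gi]; split=> x.
- rewrite (_ : (fun y => _) = (fun y => complex.Re (f y) * complex.Re (g y)
      - complex.Im (f y) * complex.Im (g y))); last first.
    by apply/funext => y; case: (f y) (g y) => [a b] [c d].
  by apply: cvgB; apply: cvgM; [exact: fr|exact: gr|exact: fi|exact: gi].
- rewrite (_ : (fun y => _) = (fun y => complex.Re (f y) * complex.Im (g y)
      + complex.Im (f y) * complex.Re (g y))); last first.
    by apply/funext => y; case: (f y) (g y) => [a b] [c d].
  by apply: cvgD; apply: cvgM; [exact: fr|exact: gi|exact: fi|exact: gr].
Qed.

End Ccontinuous.

Section Representations.
Context {R : realType} {G : topologicalGroupType}.

(* Continuous representations on C^n, acting on column vectors. *)
Record representation := Representation {
  rdim : nat ;
  rmx :> G -> 'M[R[i]]_rdim ;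
  rmx1 : rmx 1%g = 1%:M ;
  rmxM : forall x y : G, rmx (x * y)%g = rmx x *m rmx y ;
  rmx_continuous : forall i j, ccontinuous (fun x => rmx x i j) }.

Implicit Types rho sigma : representation.

Definition character rho (g : G) : R[i] := \tr (rho g).

Definition rep_iso rho sigma : Prop :=
  exists (P : 'M[R[i]]_(rdim sigma, rdim rho))
         (Q : 'M[R[i]]_(rdim rho, rdim sigma)),
    [/\ P *m Q = 1%:M, Q *m P = 1%:M &
        forall g, P *m rho g = sigma g *m P].

Definition irreducible rho : Prop :=
  (0 < rdim rho)%N /\
  forall U : {vspace 'cV[R[i]]_(rdim rho)},
    (forall (g : G) v, v \in U -> rho g *m v \in U) ->
    U = 0%VS \/ U = fullv.

Record irrep := Irrep {
  irrep_rep :> representation ;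
  irrepP : irreducible irrep_rep }.

HB.instance Definition _ := gen_eqMixin irrep.
HB.instance Definition _ := gen_choiceMixin irrep.

Lemma rep_iso_refl rho : rep_iso rho rho.
Proof.
by exists 1%:M, 1%:M; split; rewrite ?mulmx1// => g; rewrite mulmx1 mul1mx.
Qed.

Lemma rep_iso_sym rho sigma : rep_iso rho sigma -> rep_iso sigma rho.
Proof.
move=> [P [Q [PQ QP PE]]]; exists Q, P; split=> // g.
by rewrite -[LHS]mulmx1 -PQ mulmxA -(mulmxA Q) -PE !mulmxA QP mul1mx.
Qed.

Lemma rep_iso_trans rho sigma theta :
  rep_iso rho sigma -> rep_iso sigma theta -> rep_iso rho theta.
Proof.
move=> [P [Q [PQ QP PE]]] [P' [Q' [PQ' QP' PE']]].
exists (P' *m P), (Q *m Q'); split.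
- by rewrite mulmxA -(mulmxA P') PQ mulmx1.
- by rewrite mulmxA -(mulmxA Q) QP' mulmx1.
- by move=> g; rewrite -mulmxA PE !mulmxA PE'.
Qed.

Definition irrep_iso (phi psi : irrep) : bool := `[< rep_iso phi psi >].

Lemma irrep_iso_refl : reflexive irrep_iso.
Proof. by move=> phi; apply/asboolP; exact: rep_iso_refl. Qed.

Lemma irrep_iso_sym : symmetric irrep_iso.
Proof. by move=> phi psi; apply/asboolP/asboolP; exact: rep_iso_sym. Qed.

Lemma irrep_iso_trans : transitive irrep_iso.
Proof.
move=> psi phi theta /asboolP h1 /asboolP h2; apply/asboolP.
exact: rep_iso_trans h1 h2.
Qed.

Canonical irrep_iso_equiv :=
  EquivRel irrep_iso irrep_iso_refl irrep_iso_sym irrep_iso_trans.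

(* Isomorphism classes of irreducible representations of G; [repr] picks a
   representative of a class. *)
Definition irrClass := {eq_quot irrep_iso}%qT.

Lemma trivial_rep_continuous (i j : 'I_1) :
  ccontinuous (fun _ : G => (1%:M : 'M[R[i]]_1) i j).
Proof. exact: ccontinuous_cst. Qed.

Definition trivial_rep : representation :=
  @Representation 1 (fun=> 1%:M) erefl
    (fun _ _ => esym (mulmx1 _)) trivial_rep_continuous.

Lemma trivial_rep_irreducible : irreducible trivial_rep.
Proof.
split=> //= U _; have [|U0] := eqVneq U 0%VS; first by left.
right; apply/eqP; rewrite eqEdim subvf /= dimvf /dim/= muln1.
by rewrite lt0n dimv_eq0.
Qed.

Definition trivial_irrep : irrep := Irrep trivial_rep_irreducible.

Definition trivial_class : irrClass := (\pi_irrClass trivial_irrep)%qT.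

Section Tensor.
Variables rho sigma : representation.

Lemma tensor_rep1 : rho 1%g *t sigma 1%g = 1%:M.
Proof.
rewrite !rmx1; apply/matrixP => i j.
case: (mxtens_indexP i) (mxtens_indexP j) => [i1 i2] [j1 j2].
rewrite tensmxE !mxE -natrM mulnb (can_eq (@mxtens_indexK _ _)).
by rewrite xpair_eqE.
Qed.

Lemma tensor_repM (x y : G) :
  rho (x * y)%g *t sigma (x * y)%g =
  (rho x *t sigma x) *m (rho y *t sigma y).
Proof. by rewrite !rmxM tensmx_mul. Qed.

Lemma tensor_rep_continuous i j :
  ccontinuous (fun x => (rho x *t sigma x) i j).
Proof.
rewrite (_ : (fun x => _) = (fun x =>
  rho x (mxtens_unindex i).1 (mxtens_unindex j).1 *
  sigma x (mxtens_unindex i).2 (mxtens_unindex j).2)).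
  by apply: ccontinuousM; exact: rmx_continuous.
by apply/funext => x; rewrite mxE.
Qed.

Definition tensor_rep : representation :=
  Representation tensor_rep1 tensor_repM tensor_rep_continuous.

End Tensor.

Section DirectSum.
Variables (k : nat) (s : 'I_k -> irrep).

Lemma dsum_rep1 : \mxdiag_i s i 1%g = 1%:M.
Proof. by under eq_mxdiag do rewrite rmx1; rewrite mxdiagZ. Qed.

Lemma dsum_repM (x y : G) :
  \mxdiag_i s i (x * y)%g = (\mxdiag_i s i x) *m (\mxdiag_i s i y).
Proof.
rewrite [X in _ *m X]/mxdiag mul_mxdiag_mxblock; apply/eq_mxblock => i j.
case: eqP => [->|_]; last by rewrite mulmx0.
by rewrite !conform_mx_id rmxM.
Qed.

Lemma dsum_rep_continuous u v :
  ccontinuous (fun x => (\mxdiag_i s i x) u v).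
Proof.
rewrite (_ : (fun x => _) = (fun x => (if tagnat.sig1 u == tagnat.sig1 v
    then conform_mx 0 (s (tagnat.sig1 u) x) else 0) (tagnat.sig2 u) (tagnat.sig2 v))); last first.
  by apply/funext => x; rewrite mxE.
move: (tagnat.sig1 u) (tagnat.sig1 v) (tagnat.sig2 u) (tagnat.sig2 v) => i j a b.
have [ij|_] := eqVneq i j; last exact: ccontinuous_cst.
move: b; rewrite -ij => b.
under eq_fun do rewrite conform_mx_id.
exact: rmx_continuous.
Qed.

Definition dsum_rep : representation :=
  Representation dsum_rep1 dsum_repM dsum_rep_continuous.

End DirectSum.

(* Number of summands isomorphic to phi in a decomposition of rho as a
   direct sum of irreducibles. It is defined by choice of a decomposition; the
   default value 0 is never used when G is compact (complete reducibility), and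
   all decompositions then give the same number. *)
Definition multiplicity (phi : irrep) rho : nat :=
  xget 0%N [set m | exists (k : nat) (s : 'I_k -> irrep),
    rep_iso rho (dsum_rep s) /\ m = #|[set i | irrep_iso (s i) phi]%SET|].

End Representations.

Arguments representation R G : clear implicits.
Arguments irrep R G : clear implicits.
Arguments irrClass R G : clear implicits.
Arguments trivial_rep {R G}.
Arguments trivial_class {R G}.

(* Main.v *)
(* Stein's method of exchangeable pairs. The pair is (W(g), W(g alpha)) with g
   Haar distributed; it is exchangeable because alpha^-1 is conjugate to alpha.
   For a class function F the operator \int F(g) phi(g) dg is scalar by Schur's
   lemma, so that E[chi^phi(g alpha) F(g)] = chi^phi(alpha)/dim(phi) *
   E[chi^phi(g) F(g)]: averaging over the conjugates of alpha is not needed.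
   Decomposing tau^2 into irreducibles then turns the conditional second
   moment and the fourth moment of W(g alpha) - W(g) into character sums, which
   orthogonality evaluates. The Kolmogorov distance is bounded by solving
   Stein's equation for the indicator of ]-oo, x0] linearly smoothed over an
   interval of length d, and then optimising d. *)
Require Import Defs.
From HB Require Import structures.
From mathcomp Require Import all_boot all_order all_algebra.
From mathcomp Require Import all_classical all_reals all_analysis.
From mathcomp Require Import complex mxtens generic_quotient.
From mathcomp Require Import measurable_realfun ring lra.

Set Implicit Arguments.
Unset Strict Implicit.
Unset Printing Implicit Defensive.

Import Order.TTheory GRing.Theory Num.Theory.
Import numFieldNormedType.Exports.
Local Open Scope classical_set_scope.
Local Open Scope ring_scope.

(** * Integration of continuous functions and Haar measure *)

(** The constants arise as follows. Write D = W(g alpha) - W(g), k = 1 / sqrt(2 pi), Q for the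
    substitute of the conditional mean of D^2, and S for the second character sum. Since the Stein
    solution has |f'| <= 2, one error term is 2 E|1 - Q/(2a)|, at most the square root of E(2 -
    Q/a)^2; the trivial constituent of tau^2 cancels the constant 2, hence the sum over phi != 1.
    The rest is d k / 2 + E|D|^3 / (2 a d). As E D^2 = 2a and E D^4 = a S, Cauchy-Schwarz gives
    E|D|^3 <= a sqrt(2 S), and the two halves are equal for d = (S / pi)^(1/4) / k. The delicate
    point is that f' has Lipschitz constant 1/d and not 2/d: in f' = h - E h + w f the step h
    decreases while w f(w) increases, so the two slopes do not add up. This is proved from a closed
    form of f in terms of the normal distribution function and its antiderivative, where Mills-type
    inequalities replace estimates of integrals. Sums over isomorphism classes are handled as sums
    over pairs of isomorphic constituents of tau^2, m^2 being the number of such pairs. *)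

Lemma continuous_compf (T U V : topologicalType) (f : U -> V) (h : T -> U) :
  continuous f -> continuous h -> continuous (fun x => f (h x)).
Proof. by move=> cf ch x; apply: (@continuous_comp _ _ _ h f); [exact: ch|exact: cf]. Qed.

Section ContinuityRules.
Context {R : realType} {T : topologicalType}.
Implicit Types f g : T -> R.

Lemma continuous_funM f g : continuous f -> continuous g ->
  continuous (fun x => f x * g x).
Proof. by move=> cf cg x; apply: cvgM; [exact: cf|exact: cg]. Qed.

Lemma continuous_funD f g : continuous f -> continuous g ->
  continuous (fun x => f x + g x).
Proof. by move=> cf cg x; apply: cvgD; [exact: cf|exact: cg]. Qed.

Lemma continuous_funN f : continuous f -> continuous (fun x => - f x).
Proof. by move=> cf x; apply: cvgN; exact: cf. Qed.

Lemma continuous_funX f n : continuous f -> continuous (fun x => f x ^+ n).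
Proof.
move=> cf; elim: n => [|n IH]; first by move=> x; exact: cvg_cst.
by under eq_fun do rewrite exprS; exact: continuous_funM.
Qed.

Lemma continuous_fun_norm f : continuous f -> continuous (fun x => `|f x|).
Proof. by move=> cf x; apply: cvg_norm; exact: cf. Qed.

Lemma continuous_fun_cst (c : R) : continuous (fun _ : T => c).
Proof. by move=> x; exact: cvg_cst. Qed.

Lemma continuous_fun_sum (I : Type) (r : seq I) (P : pred I) (f : I -> T -> R) :
  (forall i, continuous (f i)) ->
  continuous (fun x => \sum_(i <- r | P i) f i x).
Proof.
move=> cf; elim: r => [|i r IH].
  by under eq_fun do rewrite big_nil; exact: continuous_fun_cst.
under eq_fun do rewrite big_cons.
by case: (P i) => //; exact: continuous_funD.
Qed.

End ContinuityRules.

(** No rule treats compositions: their continuity is put in the context beforehand and found by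
    [assumption]. *)
Ltac cont := repeat first [assumption | lazymatch goal with
  | |- forall x0, continuous_at x0 (fun x => (_ + _)%R) => apply: continuous_funD
  | |- forall x0, continuous_at x0 (fun x => (- _)%R) => apply: continuous_funN
  | |- forall x0, continuous_at x0 (fun x => (_ * _)%R) => apply: continuous_funM
  | |- forall x0, continuous_at x0 (fun x => (_ ^+ _)%R) => apply: continuous_funX
  | |- forall x0, continuous_at x0 (fun x => `|_|%R) => apply: continuous_fun_norm
  end | apply: continuous_fun_cst].

Section ContinuousIntegral.
Context {R : realType} {T : ptopologicalType}.
Variable mu : probability (borelType T) R.
Hypothesis cT : compact [set: T].

Lemma open_borel_measurable (A : set T) :
  open A -> measurable (A : set (borelType T)).
Proof. by move=> oA; apply: sub_sigma_algebra. Qed.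

Lemma closed_borel_measurable (A : set T) :
  closed A -> measurable (A : set (borelType T)).
Proof.
move=> cA; rewrite -[A]setCK; apply: measurableC.
by apply: open_borel_measurable; rewrite openC.
Qed.

Lemma continuous_borel_measurable (f : T -> R) :
  continuous f -> measurable_fun [set: borelType T] f.
Proof.
move=> cf; apply: (measurability _ (RGenOpens.measurableE R)).
move=> _ [_ [a [b ->] <-]]; rewrite setTI.
by apply: open_borel_measurable; apply: open_comp => // x _; exact: cf.
Qed.

Lemma continuous_compact_bounded (f : T -> R) :
  continuous f -> exists M, forall x, `|f x| <= M.
Proof.
move=> cf.
have : compact (f @` setT).
  by apply: continuous_compact => //; apply: continuous_subspaceT.
move/compact_bounded => [M [Mr MP]]; exists (M + 1) => x.
by apply: MP; [rewrite ltrDl|exists x].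
Qed.

Lemma continuous_integrable (f : T -> R) :
  continuous f -> mu.-integrable [set: borelType T] (EFin \o f).
Proof.
move=> cf; apply: measurable_bounded_integrable => //.
- by rewrite [X in (X < _)%E](probability_setT mu) ltry.
- exact: continuous_borel_measurable.
have [M HM] := continuous_compact_bounded cf.
exists M; split=> [|K MK x _]; first exact: num_real.
exact: le_trans (HM x) (ltW MK).
Qed.

(** On a compact space continuous integrands are bounded, hence integrable, so a real-valued
    integral is enough and every integrability condition becomes a continuity condition. *)
Definition cint (f : T -> R) : R := \int[mu]_(x in [set: borelType T]) f x.

Lemma eq_cint (f g : T -> R) : f =1 g -> cint f = cint g.
Proof. by move=> /funext ->. Qed.

Lemma cint_cst (c : R) : cint (fun=> c) = c.
Proof.
by rewrite /cint Rintegral_cst// [X in fine X](probability_setT mu) mulr1.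
Qed.

Lemma cintD (f g : T -> R) : continuous f -> continuous g ->
  cint (fun x => f x + g x) = cint f + cint g.
Proof. by move=> cf cg; apply: RintegralD => //; exact: continuous_integrable. Qed.

Lemma cintZ (c : R) (f : T -> R) : continuous f ->
  cint (fun x => c * f x) = c * cint f.
Proof. by move=> cf; apply: RintegralZl => //; exact: continuous_integrable. Qed.

Lemma cintB (f g : T -> R) : continuous f -> continuous g ->
  cint (fun x => f x - g x) = cint f - cint g.
Proof. by move=> cf cg; apply: RintegralB => //; exact: continuous_integrable. Qed.

Lemma le_cint (f g : T -> R) : continuous f -> continuous g ->
  (forall x, f x <= g x) -> cint f <= cint g.
Proof.
by move=> cf cg fg; apply: le_Rintegral => //; exact: continuous_integrable.
Qed.

Lemma cint_ge0 (f : T -> R) : (forall x, 0 <= f x) -> 0 <= cint f.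
Proof. by move=> f0; apply: Rintegral_ge0. Qed.

(** By compactness 1/f is bounded by some [M], so that f stays above [M^-1]. *)
Lemma cint_gt0 (f : T -> R) : continuous f ->
  (forall x, 0 < f x) -> 0 < cint f.
Proof.
move=> cf f0.
have cfV : continuous (fun x => (f x)^-1).
  by move=> x; apply: cvgV; [rewrite gt_eqF|exact: cf].
have [M HM] := continuous_compact_bounded cfV.
have M0 : 0 < M.
  by apply: lt_le_trans (HM point); rewrite normr_gt0 invr_eq0 gt_eqF.
apply: (@lt_le_trans _ _ M^-1); first by rewrite invr_gt0.
rewrite -[M^-1]cint_cst; apply: le_cint => // [x|x]; first exact: cvg_cst.
rewrite -[f x]invrK lef_pV2 ?posrE ?invr_gt0//.
by apply: le_trans (HM x); rewrite ger0_norm// invr_ge0 ltW.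
Qed.

Lemma normr_cint (f : T -> R) : continuous f ->
  `|cint f| <= cint (fun x => `|f x|).
Proof. by move=> cf; apply: le_normr_Rintegral => //; exact: continuous_integrable. Qed.

Lemma cint_indic_le (A : set (borelType T)) (f : T -> R) : measurable A ->
  continuous f -> (forall x, (\1_A x : R) <= f x) -> fine (mu A) <= cint f.
Proof.
move=> mA cf Af.
have -> : fine (mu A) = cint (\1_A).
  by rewrite /cint /Rintegral integral_indic// setIT.
apply: le_Rintegral => //; last exact: continuous_integrable.
by apply: integrable_indic => //; rewrite (le_lt_trans (probability_le1 _ _))// ltry.
Qed.

Lemma cint_indic_ge (A : set (borelType T)) (f : T -> R) : measurable A ->
  continuous f -> (forall x, f x <= (\1_A x : R)) -> cint f <= fine (mu A).
Proof.
move=> mA cf Af.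
have -> : fine (mu A) = cint (\1_A).
  by rewrite /cint /Rintegral integral_indic// setIT.
apply: le_Rintegral => //; first exact: continuous_integrable.
by apply: integrable_indic => //; rewrite (le_lt_trans (probability_le1 _ _))// ltry.
Qed.

(* The discriminant of [t |-> cint (t f + g)^2] is nonpositive. *)
Lemma cint_cauchy_schwarz (f g : T -> R) : continuous f -> continuous g ->
  cint (fun x => f x * g x) ^+ 2 <=
  cint (fun x => f x ^+ 2) * cint (fun x => g x ^+ 2).
Proof.
move=> cf cg.
pose A := cint (fun x => f x * f x); pose B := cint (fun x => f x * g x).
pose C := cint (fun x => g x * g x).
have key s t : 0 <= s * s * A + 2 * s * t * B + t * t * C.
  have <- : cint (fun x => (s * f x + t * g x) ^+ 2)
       = s * s * A + 2 * s * t * B + t * t * C.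
    rewrite /A /B /C -!cintZ -?cintD; [|by cont..].
    by apply: eq_cint => x; ring.
  by apply: cint_ge0 => x; exact: sqr_ge0.
rewrite (_ : cint (fun x => f x ^+ 2) = A); last by apply: eq_cint => x; rewrite expr2.
rewrite (_ : cint (fun x => g x ^+ 2) = C); last by apply: eq_cint => x; rewrite expr2.
rewrite -/B.
have A0 : 0 <= A by have := key 1 0; lra.
have C0 : 0 <= C by have := key 0 1; lra.
have [A_gt0|] := ltP 0 A.
  have := key B (- A); rewrite -(pmulr_rge0 _ A_gt0) => k.
  have : 0 <= A * (A * C - B ^+ 2) by have := key (-B) A; nra.
  by rewrite pmulr_rge0// subr_ge0.
move=> A_le0; have {A_le0}A0 : A = 0 by apply/eqP; rewrite eq_le A_le0.
have [->|B0] := eqVneq B 0; first by rewrite A0 expr0n/= mul0r.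
(* For [A = 0] the form is affine in its first argument; this value makes it equal to -1, a
   contradiction. *)
have := key (- (C + 1) / (2 * B)) 1; rewrite A0 !mulr0 add0r.
have -> : 2 * (- (C + 1) / (2 * B)) * 1 * B = - (C + 1) by field.
lra.
Qed.

End ContinuousIntegral.

(** Measurability refers to the product of the Borel sigma-algebras, not to the Borel sigma-algebra
    of the product. A countable base makes every open set of the product a countable union of open
    rectangles, which lie in the former. *)
Lemma second_countable_prod_measurable (R : realType) (T : ptopologicalType)
    (K : T * T -> R) : @second_countable T -> continuous K ->
  measurable_fun [set: borelType T * borelType T] K.
Proof.
move=> [B cB [oB bB]] cK; apply: (measurability _ (RGenOpens.measurableE R)).
move=> _ [_ [a [b ->] <-]]; rewrite setTI.
have oO : open (K @^-1` `]a, b[) by apply: open_comp => // x _; exact: cK.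
pose I := [set uv | [/\ B uv.1, B uv.2 & uv.1 `*` uv.2 `<=` K @^-1` `]a, b[]].
have cI : countable [set: I].
  rewrite (eq_countable (card_setT I)).
  apply: sub_countable (countableX cB cB).
  by apply: subset_card_le => -[u v] [].
rewrite (_ : K @^-1` _ = \bigcup_(i : I) ((val i).1 `*` (val i).2)).
  apply: countable_bigcupT_measurable => // -[[u v] /= uv].
  move: (uv); rewrite inE => -[Bu Bv _].
  by apply: measurableX; apply: open_borel_measurable; apply: oB.
apply/seteqP; split=> [[x y] Kxy|xy [[[u v] /= uv] _]]; last first.
  by move: (uv); rewrite inE => -[_ _ +]; apply.
have : nbhs (x, y) (K @^-1` `]a, b[) by apply: open_nbhs_nbhs.
move=> [[P Q] /= [xP yQ] PQ].
have [U [BU Ux] UP] := bB x _ xP.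
have [V [BV Vy] VQ] := bB y _ yQ.
have UV : I (U, V).
  by split=> // -[p q] /= [Up Vq]; apply: PQ; split; [apply: UP|apply: VQ].
by exists (SigSub (mem_set UV)).
Qed.

(** * Haar integral: invariance under translations, inversion and conjugation *)

Section Haar.
Context {R : realType} {G : topologicalGroupType}.
Variable mu : probability (borelType G) R.
Hypothesis cG : compact [set: G].
Hypothesis scG : @second_countable G.
Hypothesis haar : is_haar mu.

Lemma continuous_comp2 (f g : G -> G) : continuous f -> continuous g ->
  continuous (fun x => (f x * g x)%g).
Proof.
move=> cf cg x; apply: (@continuous_comp _ _ _ (fun x => (f x, g x))
    (fun z : G * G => (z.1 * z.2)%g)); last exact: mulg_continuous.
by apply: cvg_pair; [exact: cf|exact: cg].
Qed.

Lemma continuous_lmulg (g : G) : continuous (fun x : G => (g * x)%g).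
Proof. by apply: continuous_comp2 => x //; exact: cvg_cst. Qed.

Lemma continuous_rmulg (g : G) : continuous (fun x : G => (x * g)%g).
Proof. by apply: continuous_comp2 => x //; exact: cvg_cst. Qed.

Lemma cint_mull (f : G -> R) (g : G) : continuous f ->
  cint mu (fun x => f (g * x)%g) = cint mu f.
Proof.
move=> cf.
have mphi : measurable_fun [set: borelType G] (fun x : G => (g * x)%g : borelType G).
  apply: (@measurability _ _ (borelType G) (borelType G) setT _ (@open G) erefl).
  move=> _ [A oA <-].
  rewrite setTI; apply: open_borel_measurable; apply: open_comp => // x _.
  exact: continuous_lmulg.
rewrite /cint /Rintegral; congr fine.
rewrite -[LHS](@integral_pushforward _ _ (borelType G) (borelType G) R
  (fun x : G => (g * x)%g) mphi mu setT (EFin \o f))//.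
- apply: eq_measure_integral => A mA _; rewrite /pushforward.
  rewrite -[RHS](haar g^-1%g)//; congr (mu _).
  apply/seteqP; split=> [x Agx|_ [x Ax <-]] /=; last by rewrite mulVKg.
  by exists (g * x)%g => //; rewrite mulKg.
- by apply/measurable_EFinP; exact: continuous_borel_measurable.
- apply: continuous_integrable => //.
  exact: continuous_compf (@continuous_lmulg g).
Qed.

Lemma cint_fubini (K : G * G -> R) : continuous K ->
  cint mu (fun x => cint mu (fun y => K (x, y))) =
  cint mu (fun y => cint mu (fun x => K (x, y))).
Proof.
move=> cK.
have mK := second_countable_prod_measurable scG cK.
have [M HM] : exists M, forall z, `|K z| <= M.
  have : compact (K @` setT).
    apply: continuous_compact; first exact: continuous_subspaceT.
    by rewrite -setXTT; exact: compact_setX.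
  move/compact_bounded => [M [Mr MP]]; exists (M + 1) => x.
  by apply: MP; [rewrite ltrDl|exists x].
have iK : (mu \x mu)%E.-integrable setT (EFin \o K).
  apply: measurable_bounded_integrable => //.
  - have := product_measure1E mu mu (@measurableT _ (borelType G))
      (@measurableT _ (borelType G)).
    rewrite setXTT [X in (X * _)%E](probability_setT mu).
    rewrite [X in (_ * X)%E](probability_setT mu) mul1e => mm1.
    by rewrite [X in (X < _)%E]mm1 ltry.
  - exists M; split=> [|k Mk x _]; first exact: num_real.
    exact: le_trans (HM x) (ltW Mk).
have cK1 x : continuous (fun y => K (x, y)).
  by apply: continuous_compf => // y; apply: cvg_pair => //; exact: cvg_cst.
have cK2 y : continuous (fun x => K (x, y)).
  by apply: continuous_compf => // x; apply: cvg_pair => //; exact: cvg_cst.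
rewrite {1 3}/cint /Rintegral.
under eq_integral => x _.
  rewrite /cint /Rintegral fineK; last first.
    by apply: integrable_fin_num => //; apply: continuous_integrable.
  over.
under [in RHS]eq_integral => x _.
  rewrite /cint /Rintegral fineK; last first.
    by apply: integrable_fin_num => //; apply: continuous_integrable.
  over.
by rewrite (Fubini iK).
Qed.

(** Unimodularity from left invariance: f(x^-1 y) is integrated in both orders. For fixed x,
    translating y gives the integral of f; for fixed y, translating x gives that of f(x^-1). *)
Lemma cint_inv (f : G -> R) : continuous f ->
  cint mu (fun x => f x^-1%g) = cint mu f.
Proof.
move=> cf.
have cfV : continuous (fun x : G => f x^-1%g).
  by apply: continuous_compf => //; exact: invg_continuous.
have E1 x : cint mu (fun y => f (x^-1 * y)%g) = cint mu f by exact: cint_mull.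
have E2 y : cint mu (fun x => f (x^-1 * y)%g) = cint mu (fun x => f x^-1%g).
  rewrite -[RHS](@cint_mull (fun x => f x^-1%g) y^-1%g)//.
  by congr cint; apply/funext => x; rewrite invgM invgK.
have := @cint_fubini (fun z => f (z.1^-1 * z.2)%g) _ => /=.
rewrite (funext E1) (funext E2) !cint_cst => ->//.
apply: continuous_compf => // z.
apply: (@continuous_comp _ _ _ (fun z : G * G => (z.1^-1%g, z.2))
    (fun z : G * G => (z.1 * z.2)%g)); last exact: mulg_continuous.
apply: cvg_pair; last exact: cvg_snd.
by apply: continuous_comp; [exact: cvg_fst|exact: invg_continuous].
Qed.

(** Inversion exchanges right translation by g with left translation by g^-1. *)
Lemma cint_mulr (f : G -> R) (g : G) : continuous f ->
  cint mu (fun x => f (x * g)%g) = cint mu f.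
Proof.
move=> cf; have cfV : continuous (fun x : G => f x^-1%g).
  by apply: continuous_compf => //; exact: invg_continuous.
rewrite -cint_inv; last exact: continuous_compf (@continuous_rmulg g).
rewrite -[RHS]cint_inv// -[RHS](@cint_mull (fun x => f x^-1%g) g^-1%g)//; apply: eq_cint => x.
by rewrite invgM invgK.
Qed.

Lemma cint_conj (f : G -> R) (g : G) : continuous f ->
  cint mu (fun x => f (g^-1 * x * g)%g) = cint mu f.
Proof.
move=> cf; rewrite (@cint_mull (fun x => f (x * g)%g)) ?cint_mulr//.
exact: continuous_compf (@continuous_rmulg g).
Qed.

End Haar.

(** * Complex-valued and matrix-valued integrals *)

Section ComplexContinuity.
Context {R : realType} {T : topologicalType}.
Implicit Types f g : T -> R[i].

Lemma ccontinuousD f g : ccontinuous f -> ccontinuous g ->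
  ccontinuous (fun x => f x + g x).
Proof.
move=> [fr fi] [gr gi]; split=> x.
- rewrite (_ : (fun y => _) = (fun y => complex.Re (f y) + complex.Re (g y))).
    by apply: cvgD; [exact: fr|exact: gr].
  by apply/funext => y; case: (f y) (g y) => [a b] [c d].
- rewrite (_ : (fun y => _) = (fun y => complex.Im (f y) + complex.Im (g y))).
    by apply: cvgD; [exact: fi|exact: gi].
  by apply/funext => y; case: (f y) (g y) => [a b] [c d].
Qed.

Lemma ccontinuous_conj f : ccontinuous f -> ccontinuous (fun x => conjc (f x)).
Proof.
move=> [fr fi]; split=> x.
- rewrite (_ : (fun y => _) = (fun y => complex.Re (f y))); first exact: fr.
  by apply/funext => y; case: (f y).
- rewrite (_ : (fun y => _) = (fun y => - complex.Im (f y))).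
    by apply: cvgN; exact: fi.
  by apply/funext => y; case: (f y).
Qed.

Lemma ccontinuous_sum (I : Type) (r : seq I) (P : pred I) (f : I -> T -> R[i]) :
  (forall i, ccontinuous (f i)) ->
  ccontinuous (fun x => \sum_(i <- r | P i) f i x).
Proof.
move=> cf; elim: r => [|i r IH].
  by under eq_fun do rewrite big_nil; exact: ccontinuous_cst.
under eq_fun do rewrite big_cons.
by case: (P i) => //; exact: ccontinuousD.
Qed.

Lemma ccontinuous_real (f : T -> R) : continuous f ->
  ccontinuous (fun x => (f x)%:C%C).
Proof. by move=> cf; split=> //= x; exact: cvg_cst. Qed.

Lemma ccontinuous_comp (S : topologicalType) f (h : S -> T) :
  ccontinuous f -> continuous h -> ccontinuous (fun x => f (h x)).
Proof.
move=> [fr fi] ch; split.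
- exact: (@continuous_compf _ _ _ (fun x => complex.Re (f x))).
- exact: (@continuous_compf _ _ _ (fun x => complex.Im (f x))).
Qed.

End ComplexContinuity.

Section ComplexIntegral.
Context {R : realType} {T : ptopologicalType}.
Variable mu : probability (borelType T) R.
Hypothesis cT : compact [set: T].
Implicit Types f g : T -> R[i].

Definition cintC f : R[i] :=
  (cint mu (fun x => complex.Re (f x)) +i* cint mu (fun x => complex.Im (f x)))%C.

Lemma cintC_cst (c : R[i]) : cintC (fun=> c) = c.
Proof. by rewrite /cintC !cint_cst; case: c. Qed.

Lemma cintCD f g : ccontinuous f -> ccontinuous g ->
  cintC (fun x => f x + g x) = cintC f + cintC g.
Proof.
move=> [fr fi] [gr gi]; rewrite /cintC.
have -> : (fun x => complex.Re (f x + g x)) =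
    (fun x => complex.Re (f x) + complex.Re (g x)).
  by apply/funext => x; case: (f x) (g x) => [? ?] [].
have -> : (fun x => complex.Im (f x + g x)) =
    (fun x => complex.Im (f x) + complex.Im (g x)).
  by apply/funext => x; case: (f x) (g x) => [? ?] [].
by rewrite !cintD.
Qed.

Lemma cintCZ (c : R[i]) f : ccontinuous f ->
  cintC (fun x => c * f x) = c * cintC f.
Proof.
move=> [fr fi]; rewrite /cintC; case: c => a b.
have -> : (fun x => complex.Re ((a +i* b)%C * f x)) =
    (fun x => a * complex.Re (f x) - b * complex.Im (f x)).
  by apply/funext => x; case: (f x).
have -> : (fun x => complex.Im ((a +i* b)%C * f x)) =
    (fun x => a * complex.Im (f x) + b * complex.Re (f x)).
  by apply/funext => x; case: (f x).
by rewrite cintB ?cintD ?cintZ//; cont.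
Qed.

Lemma cintCZr (c : R[i]) f : ccontinuous f ->
  cintC (fun x => f x * c) = cintC f * c.
Proof.
by move=> cf; rewrite mulrC -cintCZ//; congr cintC; apply/funext => x; rewrite mulrC.
Qed.

Lemma cintC_sum (I : Type) (r : seq I) (P : pred I) (f : I -> T -> R[i]) :
  (forall i, ccontinuous (f i)) ->
  cintC (fun x => \sum_(i <- r | P i) f i x) = \sum_(i <- r | P i) cintC (f i).
Proof.
move=> cf; elim: r => [|i r IH].
  by under eq_fun do rewrite big_nil; rewrite big_nil cintC_cst.
under eq_fun do rewrite big_cons.
rewrite big_cons; case: (P i) => //.
by rewrite cintCD ?IH//; exact: ccontinuous_sum.
Qed.

Lemma cintC_real (f : T -> R) : cintC (fun x => (f x)%:C%C) = (cint mu f)%:C%C.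
Proof. by rewrite /cintC /= cint_cst. Qed.

Lemma Re_cintC f : complex.Re (cintC f) = cint mu (fun x => complex.Re (f x)).
Proof. by []. Qed.

Definition mxcontinuous (m n : nat) (A : T -> 'M[R[i]]_(m, n)) :=
  forall i j, ccontinuous (fun x => A x i j).

Definition mxint (m n : nat) (A : T -> 'M[R[i]]_(m, n)) : 'M[R[i]]_(m, n) :=
  \matrix_(i, j) cintC (fun x => A x i j).

Lemma mxcontinuous_cst m n (A : 'M[R[i]]_(m, n)) : mxcontinuous (fun=> A).
Proof. by move=> i j; exact: ccontinuous_cst. Qed.

Lemma mxcontinuousM m n p (A : T -> 'M[R[i]]_(m, n)) (B : T -> 'M[R[i]]_(n, p)) :
  mxcontinuous A -> mxcontinuous B -> mxcontinuous (fun x => A x *m B x).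
Proof.
move=> cA cB i j; under eq_fun do rewrite mxE.
by apply: ccontinuous_sum => k; exact: ccontinuousM.
Qed.

Lemma mxint_cst m n (A : 'M[R[i]]_(m, n)) : mxint (fun=> A) = A.
Proof. by apply/matrixP => i j; rewrite mxE cintC_cst. Qed.

Lemma mxint_mull m n p (A : 'M[R[i]]_(m, n)) (B : T -> 'M[R[i]]_(n, p)) :
  mxcontinuous B -> mxint (fun x => A *m B x) = A *m mxint B.
Proof.
move=> cB; apply/matrixP => i j; rewrite !mxE.
under eq_fun do rewrite mxE.
rewrite cintC_sum => [|k]; last by apply: ccontinuousM => //; exact: ccontinuous_cst.
by apply: eq_bigr => k _; rewrite cintCZ ?mxE.
Qed.

Lemma mxint_mulr m n p (A : T -> 'M[R[i]]_(m, n)) (B : 'M[R[i]]_(n, p)) :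
  mxcontinuous A -> mxint (fun x => A x *m B) = mxint A *m B.
Proof.
move=> cA; apply/matrixP => i j; rewrite !mxE.
under eq_fun do rewrite mxE.
rewrite cintC_sum => [|k]; last by apply: ccontinuousM => //; exact: ccontinuous_cst.
by apply: eq_bigr => k _; rewrite cintCZr ?mxE.
Qed.

Lemma mxint_trace n (A : T -> 'M[R[i]]_n) : mxcontinuous A ->
  \tr (mxint A) = cintC (fun x => \tr (A x)).
Proof.
move=> cA; rewrite /mxtrace cintC_sum; last by move=> i; exact: cA.
by apply: eq_bigr => i _; rewrite mxE.
Qed.

End ComplexIntegral.

Section ComplexHaar.
Context {R : realType} {G : topologicalGroupType}.
Variable mu : probability (borelType G) R.
Hypothesis cG : compact [set: G].
Hypothesis scG : @second_countable G.
Hypothesis haar : is_haar mu.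

Lemma cintC_mulg (f : G -> R[i]) (g : G) : ccontinuous f ->
  cintC mu (fun x => f (g * x)%g) = cintC mu f.
Proof.
move=> [fr fi]; rewrite /cintC; congr (_ +i* _)%C.
- exact: (cint_mull cG haar g fr).
- exact: (cint_mull cG haar g fi).
Qed.

Lemma cintC_mulgr (f : G -> R[i]) (g : G) : ccontinuous f ->
  cintC mu (fun x => f (x * g)%g) = cintC mu f.
Proof.
move=> [fr fi]; rewrite /cintC; congr (_ +i* _)%C.
- exact: (cint_mulr cG scG haar g fr).
- exact: (cint_mulr cG scG haar g fi).
Qed.

Lemma mxint_mulg m n (A : G -> 'M[R[i]]_(m, n)) (g : G) : mxcontinuous A ->
  mxint mu (fun x => A (g * x)%g) = mxint mu A.
Proof.
move=> cA; apply/matrixP => i j; rewrite !mxE.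
exact: (@cintC_mulg (fun x => A x i j)).
Qed.

Lemma mxint_mulgr m n (A : G -> 'M[R[i]]_(m, n)) (g : G) : mxcontinuous A ->
  mxint mu (fun x => A (x * g)%g) = mxint mu A.
Proof.
move=> cA; apply/matrixP => i j; rewrite !mxE.
exact: (@cintC_mulgr (fun x => A x i j)).
Qed.

End ComplexHaar.

(** * Schur's lemma, orthogonality and complete reducibility *)

Section Schur.
Context {R : realType} {G : topologicalGroupType}.

Lemma rep_mulmxV (rho : representation R G) (g : G) :
  rho g *m rho g^-1%g = 1%:M.
Proof. by rewrite -rmxM mulgV rmx1. Qed.

Lemma rep_mulVmx (rho : representation R G) (g : G) :
  rho g^-1%g *m rho g = 1%:M.
Proof. by rewrite -rmxM mulVg rmx1. Qed.

Lemma mulmx_cV_inj (F : fieldType) m n p (X : 'M[F]_(m, n)) (Z : 'M[F]_(n, p)) :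
  (forall v : 'cV_n, X *m v = 0 -> v = 0) -> X *m Z = 0 -> Z = 0.
Proof.
move=> Xinj XZ0; apply/matrixP => i j; rewrite [RHS]mxE.
have /matrixP/(_ i 0) : col j Z = 0 by apply: Xinj; rewrite colE mulmxA XZ0 mul0mx.
by rewrite !mxE.
Qed.

(** The kernel of [X] is invariant under [psi] and its image under [phi], so each is zero or
    everything. The inverse is built from preimages of the basis vectors, so that the dimensions
    need not be compared beforehand. *)
Lemma schur_zero_or_inverse (phi psi : irrep R G)
    (X : 'M[R[i]]_(rdim phi, rdim psi)) :
  (forall g, phi g *m X = X *m psi g) ->
  X = 0 \/ exists Y, X *m Y = 1%:M /\ Y *m X = 1%:M.
Proof.
move=> XE.
have [|ker0|kerT] := (irrepP psi).2 (lker (linfun (mulmx X : 'cV_ _ -> 'cV_ _))).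
- move=> g v; rewrite !memv_ker !lfunE /= => /eqP Xv.
  by rewrite mulmxA -XE -mulmxA Xv mulmx0.
- have Xinj (v : 'cV_(rdim psi)) : X *m v = 0 -> v = 0.
    move=> Xv; apply/eqP; rewrite -memv0.
    have : v \in lker (linfun (mulmx X : 'cV_ _ -> 'cV_ _)).
      by rewrite memv_ker lfunE /= Xv.
    by rewrite ker0.
  have [|im0|imT] := (irrepP phi).2 (limg (linfun (mulmx X : 'cV_ _ -> 'cV_ _))).
  + move=> g _ /memv_imgP[u _ ->]; apply/memv_imgP; exists (psi g *m u).
      exact: memvf.
    by rewrite !lfunE /= !mulmxA XE.
  + left; apply: (mulmx_cV_inj (X := 1%:M)) => [v|]; first by rewrite mul1mx.
    rewrite mul1mx; apply/matrixP => i j; rewrite [RHS]mxE.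
    have : X *m delta_mx j 0 \in limg (linfun (mulmx X : 'cV_ _ -> 'cV_ _)).
      by apply/memv_imgP; exists (delta_mx j 0); rewrite ?memvf// lfunE.
    by rewrite im0 memv0 -colE => /eqP/matrixP/(_ i 0); rewrite !mxE.
  + right.
    have /choice[u Xu] (j : 'I_(rdim phi)) : exists u, X *m u = delta_mx j 0 :> 'cV_ _.
      have : delta_mx j 0 \in limg (linfun (mulmx X : 'cV_ _ -> 'cV_ _)).
        by rewrite imT memvf.
      by move=> /memv_imgP[u _ ->]; exists u; rewrite lfunE.
    pose Y : 'M[R[i]]_(rdim psi, rdim phi) := \matrix_(i, j) u j i 0.
    have XY : X *m Y = 1%:M.
      apply/matrixP => i j; have /matrixP/(_ i 0) := Xu j; rewrite !mxE andbT => <-.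
      by apply: eq_bigr => k _; rewrite mxE.
    exists Y; split=> //; apply/eqP; rewrite -subr_eq0; apply/eqP.
    apply: (mulmx_cV_inj Xinj).
    by rewrite mulmxBr mulmxA XY mul1mx mulmx1 subrr.
- left; apply/matrixP => i j; rewrite [RHS]mxE.
  have : (delta_mx j 0 : 'cV_ _) \in lker (linfun (mulmx X : 'cV_ _ -> 'cV_ _)).
    by rewrite kerT memvf.
  by rewrite memv_ker lfunE /= -colE => /eqP/matrixP/(_ i 0); rewrite !mxE.
Qed.

Lemma schur_noniso (phi psi : irrep R G) (X : 'M[R[i]]_(rdim phi, rdim psi)) :
  (forall g, phi g *m X = X *m psi g) -> ~ rep_iso phi psi -> X = 0.
Proof.
move=> XE niso; have [//|[Y [XY YX]]] := schur_zero_or_inverse XE.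
by exfalso; apply/niso/rep_iso_sym; exists X, Y; split.
Qed.

(** Subtracting an eigenvalue leaves an intertwiner that is not invertible, hence zero. The scalar
    is expressed through the trace because the trace is what the integrals below compute. *)
Lemma schur_scalar (phi : irrep R G) (X : 'M[R[i]]_(rdim phi)) :
  (forall g, phi g *m X = X *m phi g) -> X = (\tr X / (rdim phi)%:R)%:M.
Proof.
move=> XE; have d0 := (irrepP phi).1.
have [a /eigenvalueP[v vX v0]] := eigenvalue_closed X d0.
have Xa : X = a%:M.
  apply/eqP; rewrite -subr_eq0; apply/eqP.
  have [g||[Y [XY _]]] := @schur_zero_or_inverse phi phi (X - a%:M); last 2 first.
  - by [].
  - exfalso; move/eqP: v0; apply; rewrite -[v]mulmx1 -XY mulmxA mulmxBr vX.
    by rewrite mul_mx_scalar subrr mul0mx.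
  - by rewrite mulmxBr mulmxBl XE scalar_mxC.
rewrite [in LHS]Xa Xa mxtrace_scalar -[a *+ _]mulr_natr mulfK//.
by rewrite pnatr_eq0 -lt0n.
Qed.

End Schur.

Section CharacterBasics.
Context {R : realType} {G : topologicalGroupType}.
Implicit Types rho sigma : representation R G.

Lemma character_iso rho sigma : rep_iso rho sigma ->
  character rho =1 character sigma.
Proof.
move=> [P [Q [PQ QP PE]]] g; rewrite /character.
by rewrite -[sigma g]mulmx1 -PQ mulmxA -PE mxtrace_mulC mulmxA QP mul1mx.
Qed.

Lemma character_conj rho (g h : G) :
  character rho (g^-1 * h * g)%g = character rho h.
Proof. by rewrite /character !rmxM mxtrace_mulC mulmxA rep_mulmxV mul1mx. Qed.

Lemma ccontinuous_character rho : ccontinuous (character rho).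
Proof. by apply: ccontinuous_sum => i; exact: rmx_continuous. Qed.

Lemma rep_mxcontinuous rho : mxcontinuous rho.
Proof. by move=> i j; exact: rmx_continuous. Qed.

Lemma rep_mxcontinuousV rho : mxcontinuous (fun g => rho g^-1%g).
Proof.
move=> i j; apply: (@ccontinuous_comp _ _ _ (fun x => rho x i j)).
  exact: rmx_continuous.
exact: invg_continuous.
Qed.

Lemma character_tensor rho sigma (g : G) :
  character (tensor_rep rho sigma) g = character rho g * character sigma g.
Proof.
rewrite /character /mxtrace big_distrlr/= pair_big /=.
rewrite (reindex (fun ij => mxtens_index ij)) /=.
  by apply: eq_bigr => -[i j] _ /=; rewrite tensmxE.
exists (@mxtens_unindex _ _) => i _; [exact: mxtens_indexK|exact: mxtens_unindexK].
Qed.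

Lemma character_dsum k (s : 'I_k -> irrep R G) (g : G) :
  character (dsum_rep s) g = \sum_i character (s i) g.
Proof. by rewrite /character mxtrace_mxdiag. Qed.

Lemma character_trivial (g : G) : character (@trivial_rep R G) g = 1.
Proof. by rewrite /character mxtrace1. Qed.

End CharacterBasics.

(** * Orthogonality of characters, and characters at inverses *)

Section Orthogonality.
Context {R : realType} {G : topologicalGroupType}.
Variable mu : probability (borelType G) R.
Hypothesis cG : compact [set: G].
Hypothesis scG : @second_countable G.
Hypothesis haar : is_haar mu.

(** The projection of matrices onto intertwiners from [sigma] to [rho]; at a matrix unit its entries
    are integrals of products of matrix coefficients. *)
Definition average (rho sigma : representation R G)
    (X : 'M[R[i]]_(rdim rho, rdim sigma)) :=
  mxint mu (fun g => rho g *m X *m sigma g^-1%g).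

Lemma average_mxcontinuous (rho sigma : representation R G)
    (X : 'M[R[i]]_(rdim rho, rdim sigma)) :
  mxcontinuous (fun g => rho g *m X *m sigma g^-1%g).
Proof.
apply: mxcontinuousM; last exact: rep_mxcontinuousV.
by apply: mxcontinuousM; [exact: rep_mxcontinuous|exact: mxcontinuous_cst].
Qed.

Lemma average_intertwines (rho sigma : representation R G)
    (X : 'M[R[i]]_(rdim rho, rdim sigma)) (x : G) :
  rho x *m average X = average X *m sigma x.
Proof.
rewrite /average -mxint_mull//; last exact: average_mxcontinuous.
rewrite -(mxint_mulg cG haar x (@average_mxcontinuous rho sigma X)).
rewrite -mxint_mulr//.
  congr mxint; apply/funext => g; rewrite invgM !rmxM -!mulmxA.
  by rewrite rep_mulVmx mulmx1.
move=> i j; apply: (@ccontinuous_comp _ _ _ (fun z => (rho z *m X *m sigma z^-1%g) i j)).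
  exact: average_mxcontinuous.
exact: continuous_lmulg.
Qed.

Lemma average_trace (rho : representation R G) (X : 'M[R[i]]_(rdim rho)) :
  \tr (average (rho := rho) (sigma := rho) X) = \tr X.
Proof.
rewrite /average mxint_trace//; last exact: average_mxcontinuous.
under eq_fun do rewrite mxtrace_mulC mulmxA rep_mulVmx mul1mx.
by rewrite cintC_cst.
Qed.

Lemma mulmx_delta_diag m n (A : 'M[R[i]]_m) (B : 'M[R[i]]_n) i k :
  (A *m delta_mx i k *m B) i k = A i i * B k k.
Proof.
rewrite mxE (bigD1 k)//= big1 => [|j jk]; last first.
  rewrite mxE big1 ?mul0r// => l _; rewrite mxE (negbTE jk) andbF mulr0 //.
rewrite addr0 mxE (bigD1 i)//= big1 => [|l li]; last first.
  by rewrite mxE (negbTE li) mulr0.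
by rewrite mxE !eqxx mulr1 addr0.
Qed.

(** The product of the traces is the sum over i, k of phi_ii(g) psi_kk(g^-1), and each summand is
    the entry (i, k) of a translate of a matrix unit. Schur's lemma then applies summand by
    summand. *)
Lemma cintC_characterM (phi psi : representation R G) :
  cintC mu (fun g => character phi g * character psi g^-1%g) =
  \sum_i \sum_k average (rho := phi) (sigma := psi) (delta_mx i k) i k.
Proof.
have cA i k := @average_mxcontinuous phi psi (delta_mx i k) i k.
have charE g : character phi g * character psi g^-1%g =
    \sum_i \sum_k (phi g *m delta_mx i k *m psi g^-1%g) i k.
  rewrite /character /mxtrace big_distrlr /=.
  by apply: eq_bigr => i _; apply: eq_bigr => k _; rewrite mulmx_delta_diag.
rewrite (funext charE) cintC_sum//; last by move=> i; apply: ccontinuous_sum => k.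
by apply: eq_bigr => i _; rewrite cintC_sum//; apply: eq_bigr => k _; rewrite mxE.
Qed.

(** Stated with g^-1 in place of the complex conjugate, so that Schur's lemma suffices without an
    invariant inner product. For isomorphic representations each diagonal average contributes 1/dim,
    and there are dim of them. *)
Lemma character_orthogonality_inv (phi psi : irrep R G) :
  cintC mu (fun g => character phi g * character psi g^-1%g) =
  (irrep_iso phi psi)%:R.
Proof.
rewrite /irrep_iso; have [iso|niso] := pselect (rep_iso phi psi); last first.
  rewrite asboolF// cintC_characterM big1// => i _; rewrite big1// => k _.
  rewrite (@schur_noniso _ _ phi psi (average (delta_mx i k)) _ niso) ?mxE// => g.
  exact: average_intertwines.
rewrite asboolT//.
under eq_fun => g do rewrite -(character_iso iso).
rewrite cintC_characterM.
under eq_bigr => i _.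
  under eq_bigr => k _.
    rewrite (@schur_scalar _ _ phi (average (delta_mx i k))); last first.
      by move=> g; exact: average_intertwines.
    rewrite average_trace.
    have -> : \tr (delta_mx i k : 'M[R[i]]_(rdim phi)) = (i == k)%:R.
      rewrite /mxtrace (bigD1 i)//= big1 => [|j ji].
        by rewrite mxE eqxx addr0.
      by rewrite mxE (negbTE ji).
    rewrite mxE -mulr_natr; over.
  rewrite (bigD1 i)//= big1 => [|k ki]; last first.
    by rewrite eq_sym (negbTE ki) mulr0.
  rewrite eqxx mulr1 addr0 mul1r; over.
rewrite sumr_const card_ord -[_ *+ _]mulr_natr mulVf//.
by rewrite pnatr_eq0 -lt0n (irrepP phi).1.
Qed.

(* [H := \int rho(g)^* rho(g) dg] is positive definite and
   [rho(x)^* H rho(x) = H], so that [rho(x)^*] is conjugate to [rho(x^-1)]. *)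
Lemma character_inv (rho : representation R G) (x : G) :
  character rho x^-1%g = conjc (character rho x).
Proof.
pose adj m n (A : 'M[R[i]]_(m, n)) : 'M[R[i]]_(n, m) := (map_mx conjc A)^T.
have adjM m n p (A : 'M[R[i]]_(m, n)) (B : 'M[R[i]]_(n, p)) :
    adj _ _ (A *m B) = adj _ _ B *m adj _ _ A.
  by rewrite /adj map_mxM trmx_mul.
have cadj : mxcontinuous (fun g => adj _ _ (rho g)).
  move=> i j; under eq_fun do rewrite !mxE.
  by apply: ccontinuous_conj; exact: rmx_continuous.
have cH : mxcontinuous (fun g => adj _ _ (rho g) *m rho g).
  by apply: mxcontinuousM => //; exact: rep_mxcontinuous.
pose H := mxint mu (fun g => adj _ _ (rho g) *m rho g).
have HE : adj _ _ (rho x) *m H *m rho x = H.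
  rewrite -mulmxA /H -mxint_mulr// -mxint_mull//; last first.
    by apply: mxcontinuousM => //; exact: mxcontinuous_cst.
  rewrite -[RHS](mxint_mulgr cG scG haar x cH).
  by congr mxint; apply/funext => g; rewrite rmxM adjM !mulmxA.
(* If u H = 0 and v = u^*, then u H v is the integral of the squared norm of rho(g) v. That
   integrand is positive everywhere unless v = 0, since rho(g) is invertible. *)
have Hu : H \in unitmx.
  rewrite -row_free_unit -kermx_eq0; apply/eqP/row_matrixP => k.
  rewrite row0; set u := row k _.
  have uH : u *m H = 0 by apply/sub_kermxP; exact: row_sub.
  pose v := adj _ _ u.
  have uv : u = adj _ _ v by rewrite /v /adj; apply/matrixP => a b; rewrite !mxE conjcK.
  apply/eqP; apply: contraT => u0.
  have cw : mxcontinuous (fun g => rho g *m v).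
    by apply: mxcontinuousM; [exact: rep_mxcontinuous|exact: mxcontinuous_cst].
  have trH : \tr (u *m H *m v) = 0 by rewrite uH mul0mx mxtrace0.
  pose q g : R[i] := \sum_i (rho g *m v) i 0 * conjc ((rho g *m v) i 0).
  have cq : ccontinuous q.
    apply: ccontinuous_sum => i; apply: ccontinuousM => //.
    by apply: ccontinuous_conj; exact: cw.
  have q0 g : 0 < q g.
    rewrite lt0r sumr_ge0 ?andbT => [|i _]; last exact: mulcJ_ge0.
    apply: contra u0; rewrite psumr_eq0 => [/allP qg0|i _]; last exact: mulcJ_ge0.
    have rv0 : rho g *m v = 0.
      apply/matrixP => i j; rewrite ord1 [RHS]mxE.
      have := qg0 i (mem_index_enum _).
      by rewrite mulf_eq0 conjc_eq0 orbb => /eqP.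
    have v0 : v = 0 by rewrite -[v]mul1mx -(rep_mulVmx rho g) -mulmxA rv0 mulmx0.
    by rewrite uv v0 /adj map_mx0 trmx0.
  have : 0 < cint mu (fun g => complex.Re (q g)).
    apply: cint_gt0 => //; first by case: cq.
    by move=> g; have := q0 g; rewrite ltcE => /andP[].
  suff : cintC mu q = 0 by move=> /(congr1 (@complex.Re R)) /= ->; rewrite ltxx.
  rewrite -[RHS]trH /H -mulmxA -mxint_mulr// -mxint_mull//; last first.
    by apply: mxcontinuousM => //; exact: mxcontinuous_cst.
  rewrite mxint_trace//; last first.
    apply: mxcontinuousM; first exact: mxcontinuous_cst.
    by apply: mxcontinuousM => //; exact: mxcontinuous_cst.
  congr cintC; apply/funext => g.
  rewrite uv -mulmxA mulmxA -adjM mxtrace_mulC /mxtrace.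
  apply: eq_bigr => i _.
  rewrite [RHS]mxE (big_ord1 _ (fun j => _ * adj _ _ _ j i)).
  by rewrite [adj _ _ _ _ _]mxE [X in _ = _ * X]mxE.
have : adj _ _ (rho x) = H *m rho x^-1%g *m invmx H.
  rewrite -{1}[adj _ _ _]mulmx1 -(mulmxV Hu) mulmxA; congr (_ *m _).
  by rewrite -{2}HE -mulmxA rep_mulmxV mulmx1.
move=> /(congr1 mxtrace).
rewrite -mulmxA mxtrace_mulC -mulmxA mulVmx// mulmx1 mxtrace_tr.
rewrite /character => <-.
by rewrite /mxtrace rmorph_sum; apply: eq_bigr => i _; rewrite mxE.
Qed.

End Orthogonality.

(** * Complete reducibility *)

Section CompleteReducibility.
Context {R : realType} {G : topologicalGroupType}.
Variable mu : probability (borelType G) R.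
Hypothesis cG : compact [set: G].
Hypothesis scG : @second_countable G.
Hypothesis haar : is_haar mu.

(* A matrix form of "rho is the direct sum of the irreducibles s i" avoiding
   block matrices; [A i] and [B i] are the projections and injections. *)
Definition splits (rho : representation R G) (I : finType)
    (s : I -> irrep R G) : Prop :=
  exists (A : forall i, 'M[R[i]]_(rdim (s i), rdim rho))
         (B : forall i, 'M[R[i]]_(rdim rho, rdim (s i))),
    [/\ forall i, A i *m B i = 1%:M,
        forall i j, i != j -> A i *m B j = 0,
        \sum_i B i *m A i = 1%:M &
        forall i g, A i *m rho g = s i g *m A i].

Lemma splits_dsum (rho : representation R G) k (s : 'I_k -> irrep R G) :
  splits rho s -> rep_iso rho (dsum_rep s).
Proof.
move=> [A [B [AB1 AB0 BA AE]]].
exists (\mxcol_i A i), (\mxrow_i B i); split.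
- rewrite mul_mxcol_mxrow -[RHS]mxdiagZ /mxdiag; apply/eq_mxblock => i j.
  have [ij|ij] := eqVneq i j; last by rewrite AB0.
  by case: j / ij; rewrite conform_mx_id AB1.
- by rewrite mul_mxrow_mxcol.
- move=> g /=; rewrite mul_mxdiag_mxcol.
  by rewrite mxcol_mul; apply: eq_mxcol => i; rewrite AE.
Qed.

Lemma splits_reindex (rho : representation R G) (I J : finType)
    (s : I -> irrep R G) (f : J -> I) : bijective f ->
  splits rho s -> splits rho (s \o f).
Proof.
move=> fb [A [B [AB1 AB0 BA AE]]].
exists (fun j => A (f j)), (fun j => B (f j)); split.
- by move=> i; exact: AB1.
- by move=> i j ij; apply: AB0; rewrite (bij_eq fb).
- by rewrite -BA (reindex f)//; exact: onW_bij.
- by move=> i g; exact: AE.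
Qed.

Lemma splits_dsum_ex (rho : representation R G) (I : finType)
    (s : I -> irrep R G) : splits rho s ->
  exists k (s' : 'I_k -> irrep R G), rep_iso rho (dsum_rep s').
Proof.
move=> h; exists #|I|, (s \o enum_val); apply: splits_dsum.
by apply: splits_reindex h; exact: enum_val_bij.
Qed.

Section Summand.
Variables (rho : representation R G) (r : nat).
Variables (A : 'M[R[i]]_(r, rdim rho)) (B : 'M[R[i]]_(rdim rho, r)).
Hypothesis AB1 : A *m B = 1%:M.
Hypothesis comm : forall g, B *m A *m rho g = rho g *m (B *m A).

Lemma summand1 : A *m rho 1%g *m B = 1%:M.
Proof. by rewrite rmx1 mulmx1. Qed.

Lemma summandM x y :
  A *m rho (x * y)%g *m B = (A *m rho x *m B) *m (A *m rho y *m B).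
Proof.
rewrite rmxM; transitivity (A *m (rho x *m (B *m A)) *m rho y *m B); last by rewrite !mulmxA.
by rewrite -comm !mulmxA AB1 mul1mx.
Qed.

Lemma summand_continuous i j : ccontinuous (fun x => (A *m rho x *m B) i j).
Proof.
move: i j; apply: mxcontinuousM; last exact: mxcontinuous_cst.
by apply: mxcontinuousM; [exact: mxcontinuous_cst|exact: rep_mxcontinuous].
Qed.

(** The restriction of [rho] to the image of the invariant projection [B *m A], in coordinates: [B]
    is the inclusion and [A] reads off the coordinates. *)
Definition summand : representation R G :=
  Representation summand1 summandM summand_continuous.

Lemma summand_intertwines g : A *m rho g = summand g *m A.
Proof.
rewrite /=; transitivity (A *m (rho g *m (B *m A))); last by rewrite !mulmxA.
by rewrite -comm !mulmxA AB1 mul1mx.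
Qed.

End Summand.

Lemma splits_sum (rho rho1 rho2 : representation R G) (I1 I2 : finType)
    (s1 : I1 -> irrep R G) (s2 : I2 -> irrep R G)
    (A1 : 'M[R[i]]_(rdim rho1, rdim rho)) (B1 : 'M[R[i]]_(rdim rho, rdim rho1))
    (A2 : 'M[R[i]]_(rdim rho2, rdim rho)) (B2 : 'M[R[i]]_(rdim rho, rdim rho2)) :
  A1 *m B1 = 1%:M -> A2 *m B2 = 1%:M -> A1 *m B2 = 0 -> A2 *m B1 = 0 ->
  B1 *m A1 + B2 *m A2 = 1%:M ->
  (forall g, A1 *m rho g = rho1 g *m A1) ->
  (forall g, A2 *m rho g = rho2 g *m A2) ->
  splits rho1 s1 -> splits rho2 s2 ->
  splits rho (fun i : I1 + I2 => match i with inl i => s1 i | inr j => s2 j end).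
Proof.
move=> AB1 AB2 AB12 AB21 BA AE1 AE2 [C1 [D1 [CD1 CD10 DC1 CE1]]].
move=> [C2 [D2 [CD2 CD20 DC2 CE2]]].
pose s (i : I1 + I2) : irrep R G := match i with inl i => s1 i | inr j => s2 j end.
pose A (i : I1 + I2) : 'M[R[i]]_(rdim (s i), rdim rho) :=
  match i with inl i => C1 i *m A1 | inr j => C2 j *m A2 end.
pose B (i : I1 + I2) : 'M[R[i]]_(rdim rho, rdim (s i)) :=
  match i with inl i => B1 *m D1 i | inr j => B2 *m D2 j end.
exists A, B; split.
- by case=> i /=; rewrite -mulmxA [X in _ *m X]mulmxA (AB1, AB2) mul1mx.
- move=> [i|i] [j|j] ij /=; rewrite -mulmxA [X in _ *m X]mulmxA
    (AB1, AB2, AB12, AB21) ?mul0mx ?mulmx0// mul1mx.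
  + by apply: CD10; apply: contra ij => /eqP ->.
  + by apply: CD20; apply: contra ij => /eqP ->.
- transitivity (B1 *m 1%:M *m A1 + B2 *m 1%:M *m A2); last by rewrite !mulmx1.
  rewrite big_sumType /= -DC1 -DC2.
  rewrite !mulmx_sumr !mulmx_suml.
  by congr (_ + _); apply: eq_bigr => i _; rewrite !mulmxA.
- by case=> i g /=; rewrite -mulmxA (AE1, AE2) mulmxA (CE1, CE2) mulmxA.
Qed.

(** [P] is the product of its column base and its row base, both of full rank; cancelling the outer
    factors in P P = P leaves the identity. *)
Lemma idempotent_base n (P : 'M[R[i]]_n) : P *m P = P ->
  row_base P *m col_base P = 1%:M.
Proof.
move=> PP.
apply: (row_full_inj (col_base_full P)); apply: (row_free_inj (row_base_free P)).
by rewrite mulmx1 mulmx_base mulmxA mulmx_base -mulmxA mulmx_base.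
Qed.

Lemma idempotent_base0 n (P Q : 'M[R[i]]_n) :
  P *m P = P -> Q *m Q = Q -> P *m Q = 0 -> row_base P *m col_base Q = 0.
Proof.
move=> PP QQ PQ.
have := mulmxA (row_base P) (col_base P) (row_base P).
rewrite mulmx_base idempotent_base// mul1mx => <-.
have := mulmxA (col_base Q) (row_base Q) (col_base Q).
rewrite mulmx_base idempotent_base// mulmx1 => ->.
by rewrite mulmxA -[_ *m _ *m Q]mulmxA PQ mulmx0 mul0mx.
Qed.

Lemma idempotent_rank n (P : 'M[R[i]]_n) : P *m P = P -> P != 1%:M ->
  (\rank P < n)%N.
Proof.
move=> PP P1; rewrite ltn_neqAle rank_leq_row andbT; apply: contra P1 => rP.
by apply/eqP; apply: (@row_full_inj _ _ _ _ P rP); rewrite mulmx1.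
Qed.

(* Weyl's averaging of a projection onto the invariant subspace. *)
Lemma reducible_idempotent (rho : representation R G) :
  (0 < rdim rho)%N -> ~ irreducible rho ->
  exists P : 'M[R[i]]_(rdim rho),
    [/\ P *m P = P, P != 0, P != 1%:M & forall g, rho g *m P = P *m rho g].
Proof.
move=> d0 /not_andP[//|/existsNP[U /not_implyP[Uinv /not_orP[U0 U1]]]].
(* [lin1_mx] concerns row vectors; the transpositions turn the projection onto [U] into a matrix
   acting on columns. *)
pose p := (lin1_mx (trmx \o projv U \o trmx))^T.
have pE v : p *m v = projv U v.
  by rewrite /p -[v in LHS]trmxK -trmx_mul mul_rV_lin1 /= !trmxK.
have pU v : p *m v \in U by rewrite pE memv_proj.
have pid v : v \in U -> p *m v = v by move=> vU; rewrite pE projv_id.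
have mxE_cV (A B : 'M[R[i]]_(rdim rho)) :
    (forall v : 'cV_(rdim rho), A *m v = B *m v) -> A = B.
  move=> AB; apply/matrixP => i j.
  by have /matrixP/(_ i 0) := AB (delta_mx j 0); rewrite -!colE !mxE.
have prp g : p *m rho g *m p = rho g *m p.
  by apply: mxE_cV => v; rewrite -!mulmxA pid//; apply: Uinv.
have cp := @average_mxcontinuous _ _ rho rho p.
pose P := average mu (rho := rho) (sigma := rho) p.
(* [pP] says that the average maps into [U], and [Pp] that it fixes [U]: it is again a projection
   onto [U]. *)
have pP : p *m P = P.
  rewrite /P /average -mxint_mull//.
  by congr mxint; apply/funext => g; rewrite !mulmxA prp.
have Pp : P *m p = p.
  rewrite /P /average -mxint_mulr// -[RHS](mxint_cst mu).
  congr mxint; apply/funext => g.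
  by rewrite -!mulmxA [p *m (_ *m _)]mulmxA prp mulmxA rep_mulmxV mul1mx.
exists P; split.
- by rewrite -{2}pP mulmxA Pp pP.
- apply/eqP => P0; apply: U0; apply/eqP; rewrite -subv0; apply/subvP => v vU.
  by rewrite memv0 -(pid v vU) -Pp P0 !mul0mx.
- apply/eqP => P1; apply: U1; apply/eqP; rewrite eqEsubv subvf /=.
  apply/subvP => v _; have := pU v.
  by rewrite -[p]mulmx1 -P1 pP P1 mul1mx.
- by move=> g; exact: average_intertwines.
Qed.

(** Strong induction on the dimension, an invariant idempotent [P] and its complement splitting off
    two smaller representations. Arbitrary finite index types let a direct sum be indexed by a
    disjoint union; ordinals enter only at the end. *)
Lemma complete_reducibility (rho : representation R G) :
  exists k (s : 'I_k -> irrep R G), rep_iso rho (dsum_rep s).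
Proof.
suff [I [s]] : exists (I : finType) (s : I -> irrep R G), splits rho s.
  exact: splits_dsum_ex.
have [n] := ubnP (rdim rho); elim: n => // n IH in rho *; rewrite ltnS => dn.
have [d0|d0] := posnP (rdim rho).
  exists void, (fun i : void => match i with end).
  exists (fun i : void => match i with end), (fun i : void => match i with end).
  split; [by case|by case| |by case].
  by apply/matrixP => i; have := ltn_ord i; rewrite {2}d0.
have [irr|nirr] := pselect (irreducible rho).
  exists unit, (fun=> Irrep irr), (fun=> 1%:M), (fun=> 1%:M); split.
  - by move=> _; rewrite mulmx1.
  - by move=> [] [].
  - by rewrite (big_pred1 tt) ?mulmx1// => -[].
  - by move=> _ g; rewrite mulmx1 mul1mx.
have [P [PP P0 P1 Pc]] := reducible_idempotent d0 nirr.
pose Q := 1%:M - P.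
have QQ : Q *m Q = Q.
  by rewrite /Q mulmxBr mulmx1 mulmxBl mul1mx PP subrr subr0.
have PQ : P *m Q = 0 by rewrite /Q mulmxBr mulmx1 PP subrr.
have QP : Q *m P = 0 by rewrite /Q mulmxBl mul1mx PP subrr.
have Q1 : Q != 1%:M by apply: contra P0 => /eqP Q1; rewrite -[P]mul1mx -Q1 QP.
have Qc g : rho g *m Q = Q *m rho g by rewrite /Q mulmxBr mulmxBl mulmx1 mul1mx Pc.
have comm (S : 'M[R[i]]_(rdim rho)) : (forall g, rho g *m S = S *m rho g) ->
    forall g, col_base S *m row_base S *m rho g = rho g *m (col_base S *m row_base S).
  by move=> Sc g; rewrite mulmx_base.
pose rP := summand (idempotent_base PP) (comm _ Pc).
pose rQ := summand (idempotent_base QQ) (comm _ Qc).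
have [I1 [s1 h1]] : exists (I : finType) (s : I -> irrep R G), splits rP s.
  by apply: IH; rewrite (leq_trans _ dn)//; exact: idempotent_rank.
have [I2 [s2 h2]] : exists (I : finType) (s : I -> irrep R G), splits rQ s.
  by apply: IH; rewrite (leq_trans _ dn)//; exact: idempotent_rank.
exists (I1 + I2)%type; eexists; apply: (splits_sum (rho1 := rP) (rho2 := rQ)) h1 h2.
- exact: idempotent_base.
- exact: idempotent_base.
- exact: idempotent_base0.
- exact: idempotent_base0.
- by rewrite !mulmx_base addrC subrK.
- by move=> g; exact: summand_intertwines.
- by move=> g; exact: summand_intertwines.
Qed.

End CompleteReducibility.

(** * Class functions and multiplicities *)

Section Characters.
Context {R : realType} {G : topologicalGroupType}.
Variable mu : probability (borelType G) R.
Hypothesis cG : compact [set: G].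
Hypothesis scG : @second_countable G.
Hypothesis haar : is_haar mu.

Lemma character_orthogonality (phi psi : irrep R G) :
  cintC mu (fun g => character phi g * conjc (character psi g)) =
  (irrep_iso phi psi)%:R.
Proof.
rewrite -(character_orthogonality_inv cG haar); congr cintC.
by apply/funext => g; rewrite (character_inv cG scG haar).
Qed.

(** The character at alpha^-1 is the complex conjugate of its value at alpha, and equals that value
    by conjugacy. *)
Lemma Im_character_real (rho : representation R G) (alpha h : G) :
  (alpha^-1 = h^-1 * alpha * h)%g -> complex.Im (character rho alpha) = 0.
Proof.
move=> E; have := character_inv cG scG haar rho alpha.
rewrite E character_conj; case: (character rho alpha) => a b [] /=.
by move=> /eqP; rewrite -addr_eq0 -mulr2n mulrn_eq0 => /eqP.
Qed.

Lemma cintC_conjg (f : G -> R[i]) (g : G) : ccontinuous f ->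
  cintC mu (fun x => f (g^-1 * x * g)%g) = cintC mu f.
Proof.
move=> cf; rewrite (@cintC_mulg _ _ _ cG haar (fun x => f (x * g)%g)).
  exact: cintC_mulgr.
by apply: ccontinuous_comp => //; exact: continuous_rmulg.
Qed.

(* [\int F(g) phi(g) dg] commutes with [phi] as [F] is a class function, hence
   is scalar. *)
Lemma cintC_character_mulr (phi : irrep R G) (alpha : G) (F : G -> R[i]) :
  ccontinuous F -> (forall k g, F (k^-1 * g * k)%g = F g) ->
  cintC mu (fun g => character phi (g * alpha)%g * F g) =
  character phi alpha / (rdim phi)%:R * cintC mu (fun g => character phi g * F g).
Proof.
move=> cF Fclass.
have cM : mxcontinuous (fun g => F g *: phi g).
  by move=> i j; under eq_fun do rewrite mxE; apply: ccontinuousM => //; exact: rmx_continuous.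
have cMr (B : 'M[R[i]]_(rdim phi)) : mxcontinuous (fun g => F g *: phi g *m B).
  by apply: mxcontinuousM => //; exact: mxcontinuous_cst.
pose M := mxint mu (fun g => F g *: phi g).
have trM : \tr M = cintC mu (fun g => character phi g * F g).
  rewrite mxint_trace//; congr cintC; apply/funext => g.
  by rewrite mxtraceZ mulrC.
have Mcomm x : phi x *m M = M *m phi x.
  have ME : M = phi x^-1%g *m M *m phi x.
    rewrite -mxint_mull// -mxint_mulr//; last first.
      by apply: mxcontinuousM => //; exact: mxcontinuous_cst.
    apply/matrixP => i j; rewrite !mxE.
    rewrite -[LHS](@cintC_conjg (fun g => (F g *: phi g) i j) x)//.
    congr cintC; apply/funext => g.
    by rewrite Fclass -scalemxAr -scalemxAl !rmxM.
  by rewrite {1}ME !mulmxA rep_mulmxV mul1mx.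
have -> : (fun g => character phi (g * alpha)%g * F g) =
    (fun g => \tr (F g *: phi g *m phi alpha)).
  by apply/funext => g; rewrite -scalemxAl mxtraceZ mulrC -rmxM.
rewrite -mxint_trace// mxint_mulr// -/M (schur_scalar Mcomm) trM.
by rewrite mul_scalar_mx mxtraceZ mulrC mulrA mulrAC.
Qed.

Lemma multiplicity_count (phi : irrep R G) (rho : representation R G) k
    (s : 'I_k -> irrep R G) : rep_iso rho (dsum_rep s) ->
  cintC mu (fun g => character rho g * conjc (character phi g)) =
  #|[set i | irrep_iso (s i) phi]%SET|%:R.
Proof.
move=> iso; under eq_fun do rewrite (character_iso iso) character_dsum mulr_suml.
rewrite cintC_sum// => [|i]; last first.
  apply: ccontinuousM; first exact: ccontinuous_character.
  by apply: ccontinuous_conj; exact: ccontinuous_character.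
under eq_bigr do rewrite character_orthogonality.
rewrite -natr_sum -sum1dep_card [in RHS]big_mkcond /=; congr _%:R.
Qed.

(** The count is an inner product of characters, hence the same in the decomposition picked by
    [xget] as in the given one, whose existence also excludes the default value. *)
Lemma multiplicityE (phi : irrep R G) (rho : representation R G) k
    (s : 'I_k -> irrep R G) : rep_iso rho (dsum_rep s) ->
  multiplicity phi rho = #|[set i | irrep_iso (s i) phi]%SET|.
Proof.
move=> iso; rewrite /multiplicity; case: xgetP => [m _ [k' [s' [iso' ->]]]|].
  apply/eqP; rewrite -(eqr_nat R[i]); apply/eqP.
  by rewrite -(multiplicity_count _ iso) -(multiplicity_count _ iso').
by move=> /(_ #|[set i | irrep_iso (s i) phi]%SET|) []; exists k, s.
Qed.

Lemma pi_irrepE (phi : irrep R G) (c : irrClass R G) :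
  irrep_iso phi (repr c) = (\pi_(irrClass R G) phi == c)%qT.
Proof.
by rewrite -[in RHS](reprK c) piE.
Qed.

Lemma irrep_isoE (phi psi : irrep R G) :
  irrep_iso phi psi = (\pi_(irrClass R G) phi == \pi_(irrClass R G) psi)%qT.
Proof. by rewrite piE. Qed.

(** The squared multiplicity counts pairs of constituents in the class [phi]. The support of the
    class sum lies in the list of classes of the [s i], so the sum is finite and can be exchanged
    with the sums over i and j. *)
Lemma fsum_multiplicity (rho : representation R G) k (s : 'I_k -> irrep R G)
    (P : pred (irrClass R G)) (f : irrClass R G -> R) :
  rep_iso rho (dsum_rep s) ->
  \sum_(phi \in [set phi | P phi])
    (multiplicity (repr phi) rho)%:R ^+ 2 * f phi =
  \sum_(i | P (\pi_(irrClass R G) (s i))%qT) \sum_j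
    (irrep_iso (s i) (s j))%:R * f (\pi_(irrClass R G) (s i))%qT.
Proof.
move=> iso; pose p i := (\pi_(irrClass R G) (s i))%qT.
have mE phi : (multiplicity (repr phi) rho)%:R = \sum_i (p i == phi)%:R :> R.
  rewrite (multiplicityE _ iso) -natr_sum; congr _%:R.
  rewrite -sum1dep_card big_mkcond /=; apply: eq_bigr => i _.
  by rewrite pi_irrepE; case: eqP.
pose r := undup [seq p i | i <- enum 'I_k].
rewrite (_ : [set phi | P phi] = [set` P])//.
rewrite -(@bigfs _ _ _ _ r P) ?undup_uniq//; last first.
  move=> phi _; rewrite mem_undup => phir.
  rewrite mE big1 ?expr0n ?mul0r// => i _.
  by case: eqP => // pi; move: phir; rewrite -pi map_f ?mem_enum.
have pr i : p i \in r by rewrite mem_undup map_f ?mem_enum.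
transitivity (\sum_(phi <- r | P phi) \sum_i \sum_j
    (p i == phi)%:R * ((p j == phi)%:R * f phi)).
  apply: eq_bigr => phi _; rewrite mE expr2 -mulrA mulr_suml.
  by apply: eq_bigr => i _; rewrite mulr_suml mulr_sumr.
rewrite exchange_big /= [RHS]big_mkcond /=; apply: eq_bigr => i _.
transitivity (\sum_(phi <- r) (p i == phi)%:R *
    (if P phi then \sum_j ((p j == phi)%:R * f phi) else 0)).
  rewrite big_mkcond /=; apply: eq_bigr => phi _.
  by case: (P phi); rewrite ?mulr0// mulr_sumr.
rewrite (bigD1_seq (p i)) ?undup_uniq//= [X in _ + X]big1 => [|phi phii]; last first.
  by rewrite eq_sym (negbTE phii) mul0r.
rewrite eqxx mul1r addr0; case: ifP => // _.
by apply: eq_bigr => j _; rewrite irrep_isoE eq_sym.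
Qed.

End Characters.

(** * The Gaussian distribution and Stein's equation *)

Section Derivatives.
Context {R : realType}.
Implicit Types (f g df : R -> R) (x y z a b C : R).

Lemma is_derive1_eq f x a b : is_derive x 1 f a -> a = b -> is_derive x 1 f b.
Proof. by move=> fa <-. Qed.

Lemma is_derive1D f g x a b : is_derive x 1 f a -> is_derive x 1 g b ->
  is_derive x 1 (fun y => f y + g y) (a + b).
Proof. by move=> fa gb; exact: is_deriveD. Qed.

Lemma is_derive1B f g x a b : is_derive x 1 f a -> is_derive x 1 g b ->
  is_derive x 1 (fun y => f y - g y) (a - b).
Proof. by move=> fa gb; exact: is_deriveB. Qed.

Lemma is_derive1M f g x a b : is_derive x 1 f a -> is_derive x 1 g b ->
  is_derive x 1 (fun y => f y * g y) (a * g x + f x * b).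
Proof.
move=> fa gb; have := @is_deriveM _ _ f g _ _ _ _ fa gb.
by rewrite /GRing.scale /= addrC [g x * a]mulrC.
Qed.

Lemma is_derive1_div f g x a b : g x != 0 ->
  is_derive x 1 f a -> is_derive x 1 g b ->
  is_derive x 1 (fun y => f y / g y) (a / g x - f x * b / g x ^+ 2).
Proof.
move=> gx0 fa gb.
have gV : is_derive x 1 (fun y => (g y)^-1) (- (g x) ^- 2 *: b).
  exact: is_deriveV.
apply: (is_derive1_eq (is_derive1M fa gV)).
by rewrite /GRing.scale /=; field.
Qed.

Lemma is_derive1_oppcomp f x a : is_derive (- x) 1 f a ->
  is_derive x 1 (fun y => f (- y)) (- a).
Proof.
move=> fa; have := @is_derive1_comp R f -%R x a (-1) fa _.
rewrite mulrN1; apply; exact: is_deriveN.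
Qed.

Lemma is_derive1_continuous f df : (forall x, is_derive x 1 f (df x)) ->
  continuous f.
Proof.
move=> fd x; apply: differentiable_continuous; apply/derivable1_diffP.
by case: (fd x).
Qed.

Lemma mean_value f df x y : (forall z, is_derive z 1 f (df z)) ->
  exists2 z, x <= z <= y \/ y <= z <= x & f y - f x = df z * (y - x).
Proof.
move=> fd; have cf := is_derive1_continuous fd.
have [xy|/ltW yx] := leP x y.
  have [z zxy ->] := MVT_segment xy (fun z _ => fd z) (continuous_subspaceT cf).
  by exists z => //; left; rewrite in_itv in zxy.
have [z zxy E] := MVT_segment yx (fun z _ => fd z) (continuous_subspaceT cf).
by exists z; [right; rewrite in_itv in zxy|rewrite -[LHS]opprB E -mulrN opprB].
Qed.

(** Lets a function given piecewise be differentiated at its corners by an estimate instead of a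
    comparison of one-sided derivatives. *)
Lemma is_derive1_quadratic f x C :
  (forall y, `|f y - f x| <= C * (y - x) ^+ 2) -> is_derive x 1 f 0.
Proof.
move=> fC; have C0 : 0 <= C.
  by have := le_trans (normr_ge0 _) (fC (x + 1)); rewrite addrAC subrr add0r expr1n mulr1.
suff cv : h^-1 *: (f (h *: 1 + x) - f x) @[h --> (0:R)^'] --> (0 : R).
  by split; [apply/cvg_ex; exists 0|exact/cvg_lim].
apply/cvgr0Pnorm_le => e e0; near=> h.
have h0 : h != 0 by near: h; exact: nbhs_dnbhs_neq.
rewrite normrZ normfV ler_pdivrMl ?normr_gt0//.
apply: (le_trans (fC _)); rewrite [h *: 1]mulr1 addrK -[h ^+ 2]real_normK ?num_real// expr2.
rewrite mulrCA ler_wpM2l//.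
have : `|h| <= e / (C + 1) by near: h; apply: dnbhs0_le; rewrite divr_gt0// ltr_wpDl.
rewrite ler_pdivlMr ?ltr_wpDl// => he; apply: le_trans he.
by rewrite mulrC ler_wpM2l// lerDl.
Unshelve. all: by end_near. Qed.

End Derivatives.

(** * The normal distribution function and Mills-type inequalities *)

Section Gaussian.
Context {R : realType}.
Implicit Types x y w : R.

Definition gauss_pdf : R -> R := normal_pdf 0 1.
Definition gauss_cdf x : R := \int[lebesgue_measure]_(t in `]-oo, x]) gauss_pdf t.
Definition gauss_cst : R := (Num.sqrt (2 * trigo.pi))^-1.

Lemma gauss_pdfE x : gauss_pdf x = gauss_cst * expR (- (x ^+ 2 / 2)).
Proof.
rewrite /gauss_pdf normal_pdfE ?oner_eq0//= /normal_peak /normal_fun /gauss_cst.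
by rewrite expr1n mul1r mulr_natl subr0 mulNr.
Qed.

Lemma gauss_cst_gt0 : 0 < gauss_cst.
Proof. by rewrite invr_gt0 sqrtr_gt0 mulr_gt0// pi_gt0. Qed.

Lemma gauss_pdf_integrable (D : set R) : measurable D ->
  lebesgue_measure.-integrable D (EFin \o gauss_pdf).
Proof. by move=> mD; apply: integrableS (integrable_normal_pdf 0 1). Qed.

Lemma gauss_cdfE x : gauss_cdf x =
  gauss_cst * \int[lebesgue_measure]_(t in `]-oo, x]) expR (- (t ^+ 2 / 2)).
Proof.
have -> : (fun t => expR (- (t ^+ 2 / 2))) = (fun t => gauss_cst^-1 * gauss_pdf t).
  by apply/funext => t; rewrite gauss_pdfE mulKf// gt_eqF// gauss_cst_gt0.
rewrite RintegralZl//; last exact: gauss_pdf_integrable.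
by rewrite mulVKf// gt_eqF// gauss_cst_gt0.
Qed.

Lemma gauss_cst_le1 : gauss_cst <= 1.
Proof.
rewrite /gauss_cst invf_le1 ?sqrtr_gt0 ?mulr_gt0 ?pi_gt0//.
rewrite -[leLHS]sqrtr1 ler_wsqrtr//; have := pi_ge2 R; lra.
Qed.

Lemma gauss_pdf_gt0 x : 0 < gauss_pdf x.
Proof. by rewrite gauss_pdfE mulr_gt0 ?expR_gt0 ?gauss_cst_gt0. Qed.

Lemma gauss_pdf_le x : gauss_pdf x <= gauss_cst.
Proof.
rewrite gauss_pdfE ler_piMr ?(ltW gauss_cst_gt0)//.
by rewrite -expR0 ler_expR oppr_le0 divr_ge0 ?sqr_ge0.
Qed.

Lemma gauss_pdfN x : gauss_pdf (- x) = gauss_pdf x.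
Proof. by rewrite !gauss_pdfE sqrrN. Qed.

Lemma is_derive_gauss_pdf x : is_derive x 1 gauss_pdf (- x * gauss_pdf x).
Proof.
rewrite (_ : gauss_pdf = fun x => gauss_cst * expR (- (x ^+ 2 / 2))); last first.
  by apply/funext => y; exact: gauss_pdfE.
have dq : is_derive x 1 (fun y : R => - (y ^+ 2 / 2)) (- x).
  have dc : is_derive x 1 (fun=> - 2^-1 : R) 0 by exact: is_derive_cst.
  have dX := is_derive1M (is_derive_id x 1) (is_derive1M (is_derive_id x 1) dc).
  rewrite (_ : (fun y => _) = (fun y : R => y * (y * - 2^-1))); last first.
    by apply/funext => y; rewrite expr2 mulrN mulrN mulrA.
  by apply: (is_derive1_eq dX); rewrite /=; field.
have dE : is_derive x 1 (fun y : R => expR (- (y ^+ 2 / 2))) (expR (- (x ^+ 2 / 2)) * - x).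
  exact: (is_derive1_comp (is_derive_expR _) dq).
have dc : is_derive x 1 (fun=> gauss_cst) 0 by exact: is_derive_cst.
by apply: (is_derive1_eq (is_derive1M dc dE)); rewrite /=; ring.
Qed.

Lemma is_derive_gauss_cdf x : is_derive x 1 gauss_cdf (gauss_pdf x).
Proof.
have [] := @continuous_FTC1 R gauss_pdf -oo%O x (x + 1).
- by rewrite ltrDl.
- exact: gauss_pdf_integrable.
- by rewrite ltNyr.
- by apply: continuous_normal_pdf; exact: oner_neq0.
by move=> dF F'; apply: DeriveDef => //; rewrite -F' derive1E.
Qed.

(** The identity as a random variable under the normal law: [gauss_cdf] becomes its distribution
    function and inherits bounds and limits at infinity. *)
Let idR : measurableTypeR R -> R := idfun.

#[local] HB.instance Definition _ :=
  @isMeasurableFun.Build _ _ _ _ idR (@measurable_id _ _ setT).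

Lemma gauss_cdf_cdf x :
  (gauss_cdf x)%:E = cdf (idR : {RV (normal_prob (0:R) 1) >-> R}) x.
Proof.
rewrite /gauss_cdf /Rintegral fineK//.
by apply: integrable_fin_num => //; exact: gauss_pdf_integrable.
Qed.

Lemma gauss_cdf_ge0 x : 0 <= gauss_cdf x.
Proof. by rewrite -lee_fin gauss_cdf_cdf cdf_ge0. Qed.

Lemma gauss_cdf_le1 x : gauss_cdf x <= 1.
Proof. by rewrite -lee_fin gauss_cdf_cdf cdf_le1. Qed.

Lemma gauss_cdf_cvgNy0 : gauss_cdf x @[x --> -oo] --> 0.
Proof.
have := @cvg_cdfNy0 _ _ _ _ (idR : {RV (normal_prob (0:R) 1) >-> R}).
by rewrite -(funext gauss_cdf_cdf) => /fine_cvg.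
Qed.

Lemma gauss_cdf_cvgy1 : gauss_cdf x @[x --> +oo] --> (1:R).
Proof.
have := @cvg_cdfy1 _ _ _ _ (idR : {RV (normal_prob (0:R) 1) >-> R}).
by rewrite -(funext gauss_cdf_cdf) => /fine_cvg.
Qed.

(** The sum of the values at y and -y has derivative zero, and it tends to 1 at infinity. *)
Lemma gauss_cdfN x : gauss_cdf (- x) = 1 - gauss_cdf x.
Proof.
have dK y : is_derive y 1 (fun y => gauss_cdf y + gauss_cdf (- y)) 0.
  apply: (is_derive1_eq (is_derive1D (is_derive_gauss_cdf y)
    (is_derive1_oppcomp (is_derive_gauss_cdf (- y))))).
  by rewrite gauss_pdfN subrr.
have K y : gauss_cdf y + gauss_cdf (- y) = gauss_cdf x + gauss_cdf (- x).
  exact: (@is_derive_0_is_cst R (fun y => gauss_cdf y + gauss_cdf (- y)) y x dK).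
have cN : gauss_cdf (- y) @[y --> +oo] --> 0.
  by have := gauss_cdf_cvgNy0; rewrite cvgNy_compNP.
have cK : gauss_cdf y + gauss_cdf (- y) @[y --> +oo] --> (1 + 0 : R).
  by apply: cvgD => //; exact: gauss_cdf_cvgy1.
have <- : gauss_cdf x + gauss_cdf (- x) = 1.
  rewrite (funext K) addr0 in cK.
  exact: (cvg_unique (@Rhausdorff R) (@cvg_cst _ _ _ _ _) cK).
by rewrite addrAC subrr add0r.
Qed.

Lemma gauss_cdf_le x y : x <= y -> gauss_cdf x <= gauss_cdf y.
Proof.
move=> xy; rewrite -subr_ge0.
have [z _ ->] := mean_value x y is_derive_gauss_cdf.
by rewrite mulr_ge0 ?subr_ge0// ltW ?gauss_pdf_gt0.
Qed.

Lemma gauss_cdf_lipschitz x y : x <= y ->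
  gauss_cdf y - gauss_cdf x <= gauss_cst * (y - x).
Proof.
move=> xy; have [z _ ->] := mean_value x y is_derive_gauss_cdf.
by rewrite ler_wpM2r ?subr_ge0// gauss_pdf_le.
Qed.

Lemma gauss_cdf_lip1 x y : x <= y -> gauss_cdf y - gauss_cdf x <= y - x.
Proof.
move=> xy; apply: le_trans (gauss_cdf_lipschitz xy) _.
by rewrite ler_piMl ?subr_ge0 ?gauss_cst_le1.
Qed.

(** After division by 1 + w^2 this says that [g] is nonnegative, which holds as [g] increases from
    its limit 0 at -oo. It supplies the sign of the coefficients in [slope_itv]. *)
Lemma gauss_mills_lower w : - (w * gauss_pdf w) <= (1 + w ^+ 2) * gauss_cdf w.
Proof.
have w1 y : 0 < 1 + y ^+ 2 by have := sqr_ge0 y; lra.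
pose g y := gauss_cdf y + y * gauss_pdf y / (1 + y ^+ 2).
have dg y : is_derive y 1 g (2 * gauss_pdf y / (1 + y ^+ 2) ^+ 2).
  have dq : is_derive y 1 (fun y : R => 1 + y ^+ 2) (2 * y).
    have -> : (fun y : R => 1 + y ^+ 2) = (fun y => 1 + y * y) by [].
    have dc : is_derive y 1 (fun=> 1 : R) 0 by exact: is_derive_cst.
    apply: (is_derive1_eq (is_derive1D dc (is_derive1M (is_derive_id y 1) (is_derive_id y 1)))).
    by ring.
  have dn := is_derive1M (is_derive_id y 1) (is_derive_gauss_pdf y).
  apply: (is_derive1_eq (is_derive1D (is_derive_gauss_cdf y)
    (is_derive1_div _ dn dq))); first by rewrite gt_eqF.
  by rewrite /=; field; rewrite gt_eqF.
suff g0 : 0 <= g w.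
  have := mulr_ge0 (ltW (w1 w)) g0; rewrite /g mulrDr [_ * (_ / _)]mulrC divfK ?gt_eqF//.
  lra.
apply/ler_addgt0Pr => e e0; rewrite addrC -lerBlDl sub0r.
(* For x <= -1/e one has -x <= e x^2, and the density is at most 1, so the second summand of [g x]
   is at least -e. *)
pose x := Num.min w (- e^-1).
have xw : x <= w by rewrite ge_min lexx.
have xe : x <= - e^-1 by rewrite ge_min lexx orbT.
have x0 : x < 0 by rewrite (le_lt_trans xe)// oppr_lt0 invr_gt0.
apply: (@le_trans _ _ (g x)); last first.
  rewrite -subr_ge0; have [z _ ->] := mean_value x w dg.
  rewrite mulr_ge0 ?subr_ge0// divr_ge0 ?sqr_ge0// mulr_ge0//.
  exact: ltW (gauss_pdf_gt0 _).
apply: (@le_trans _ _ (x * gauss_pdf x / (1 + x ^+ 2))); last first.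
  by rewrite lerDr gauss_cdf_ge0.
rewrite ler_pdivlMr//.
have p1 := le_trans (gauss_pdf_le x) gauss_cst_le1.
have p0 := gauss_pdf_gt0 x.
have ex : 1 <= e * - x by rewrite -ler_pdivrMl// mulr1 lerNr.
nra.
Qed.

(** For w < 0 the function [g], in which w is frozen, increases on ]-oo, w] from the limit 0; its
    value at w is the difference of the two sides. *)
Lemma gauss_mills_upper w : - (w * gauss_cdf w) <= gauss_pdf w.
Proof.
have [w0|w0] := leP 0 w.
  apply: le_trans (ltW (gauss_pdf_gt0 w)).
  by rewrite oppr_le0 mulr_ge0 ?gauss_cdf_ge0.
pose g y := gauss_pdf y + w * gauss_cdf y.
have dg y : is_derive y 1 g ((w - y) * gauss_pdf y).
  have dc : is_derive y 1 (fun=> w) 0 by exact: is_derive_cst.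
  apply: (is_derive1_eq (is_derive1D (is_derive_gauss_pdf y)
     (is_derive1M dc (is_derive_gauss_cdf y)))).
  by rewrite /=; ring.
rewrite -subr_ge0 opprK -/(g w).
apply/ler_addgt0Pr => e e0; rewrite addrC -lerBlDl sub0r.
have [M [_ HM]] : \forall x \near -oo, gauss_cdf x <= e / - w.
  have ew : 0 < e / - w by rewrite divr_gt0// oppr_gt0.
  have /cvgr0Pnorm_le/(_ _ ew) := gauss_cdf_cvgNy0.
  by apply: filterS => x; apply: le_trans; exact: ler_norm.
pose x := Num.min w (M - 1).
have xw : x <= w by rewrite ge_min lexx.
have /HM xe : x < M by rewrite gt_min ltrBlDr ltrDl ltr01 orbT.
apply: (@le_trans _ _ (g x)); last first.
  rewrite -subr_ge0; have [z zxw ->] := mean_value x w dg.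
  rewrite !mulr_ge0 ?subr_ge0 ?(ltW (gauss_pdf_gt0 _))//.
  by case: zxw => /andP[]// wz zx; apply: le_trans xw.
rewrite /g -[leLHS]add0r lerD ?(ltW (gauss_pdf_gt0 _))//.
by rewrite -[w]opprK mulNr lerN2 -ler_pdivlMl ?oppr_gt0// mulrC.
Qed.

End Gaussian.

Section GaussPrimitive.
Context {R : realType}.
Implicit Types x y w z : R.

(** The antiderivative of [gauss_cdf] vanishing at -oo, that is, the mean of max(0, x - Z) for a
    standard normal Z. *)
Definition gauss_prim x : R := x * gauss_cdf x + gauss_pdf x.

Lemma is_derive_gauss_prim x : is_derive x 1 gauss_prim (gauss_cdf x).
Proof.
apply: (is_derive1_eq (is_derive1D (is_derive1M (is_derive_id x 1)
  (is_derive_gauss_cdf x)) (is_derive_gauss_pdf x))).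
by rewrite /=; ring.
Qed.

Lemma gauss_prim_ge0 x : 0 <= gauss_prim x.
Proof. by have := gauss_mills_upper x; rewrite /gauss_prim; lra. Qed.

Lemma gauss_primN x : gauss_prim (- x) = gauss_prim x - x.
Proof. by rewrite /gauss_prim gauss_cdfN gauss_pdfN; ring. Qed.

Lemma gauss_prim_le x y : x <= y -> gauss_prim x <= gauss_prim y.
Proof.
move=> xy; rewrite -subr_ge0; have [z _ ->] := mean_value x y is_derive_gauss_prim.
by rewrite mulr_ge0 ?gauss_cdf_ge0 ?subr_ge0.
Qed.

Lemma gauss_prim_tangent x y : x <= y ->
  (y - x) * gauss_cdf x <= gauss_prim y - gauss_prim x <= (y - x) * gauss_cdf y.
Proof.
move=> xy; have [z zxy ->] := mean_value x y is_derive_gauss_prim.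
have /andP[xz zy] : x <= z <= y.
  by case: zxy => // /andP[yz zx]; rewrite (le_trans xy yz) (le_trans zx xy).
by rewrite [_ * (y - x)]mulrC !ler_wpM2l ?subr_ge0 ?gauss_cdf_le.
Qed.

(** The derivative of [g] has the sign of z - x, so [g] is minimal at x. The mean value theorem
    applied to [gauss_prim] itself would lose the factor 1/2, which enters the final constant. *)
Lemma gauss_prim_taylor x y :
  gauss_prim y <= gauss_prim x + (y - x) * gauss_cdf x + gauss_cst / 2 * (y - x) ^+ 2.
Proof.
pose g y := gauss_cst / 2 * ((y - x) * (y - x)) + (y - x) * gauss_cdf x - gauss_prim y.
have dg z : is_derive z 1 g (gauss_cst * (z - x) + gauss_cdf x - gauss_cdf z).
  have dc (c : R) : is_derive z 1 (fun=> c) 0 by exact: is_derive_cst.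
  have d1 := is_derive1B (is_derive_id z 1) (dc x).
  apply: (is_derive1_eq (is_derive1B (is_derive1D (is_derive1M (dc _)
    (is_derive1M d1 d1)) (is_derive1M d1 (dc _))) (is_derive_gauss_prim z))).
  by rewrite /=; field.
have : 0 <= g y - g x.
  have [z zxy ->] := mean_value x y dg.
  case: zxy => /andP[h1 h2].
    apply: mulr_ge0; last by lra.
    by have := gauss_cdf_lipschitz h1; lra.
  rewrite -mulrNN; apply: mulr_ge0; last by lra.
  by have := gauss_cdf_lipschitz h2; lra.
by rewrite /g expr2; lra.
Qed.

End GaussPrimitive.

(** * Stein's equation for the linearly smoothed indicator *)

Section SteinSolution.
Context {R : realType}.
Variables (x0 x1 : R).
Hypothesis x01 : x0 < x1.
Implicit Types w : R.

Let d := x1 - x0.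
Let d_gt0 : 0 < d. Proof. by rewrite subr_gt0. Qed.

(** Truncation to [x0, x1], which lets one formula cover the three pieces of the step. *)
Let c w := Num.max x0 (Num.min w x1).

Let cP w : [\/ w <= x0 /\ c w = x0, x0 <= w <= x1 /\ c w = w | x1 <= w /\ c w = x1].
Proof.
rewrite /c; have [wx1|x1w] := leP w x1; have := x01.
  by case: (leP x0 w) => h _; [constructor 2; rewrite ?h ?wx1|constructor 1; rewrite (ltW h)].
move=> /ltW h; constructor 3; rewrite ltW//; split=> //.
by rewrite max_r.
Qed.

Let c_itv w : x0 <= c w <= x1.
Proof. by have := x01; case: (cP w) => -[+ ->]; lra. Qed.

Let c_mono w w' : w <= w' -> 0 <= c w' - c w <= w' - w.
Proof. by have := x01; case: (cP w) => -[+ ->]; case: (cP w') => -[+ ->]; lra. Qed.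

(* The clamp only moves inside the interval where it is the identity. *)
Let c_between w w' : w <= w' -> c w = c w' \/ (w <= c w /\ c w' <= w').
Proof. by have := x01; case: (cP w) => -[+ ->]; case: (cP w') => -[+ ->]; lra. Qed.

Let al w := gauss_prim (c w) - gauss_prim x0.
Let be w := gauss_prim (- c w) - gauss_prim (- x1).

(* [stein_sol] is the bounded solution of [f' w - w f w = h w - E h], where
   [h = stein_step] descends linearly from 1 at [x0] to 0 at [x1] and
   [stein_mean] (written [E h]) is the mean of [h] under the standard normal
   law. Integrating by parts, everything is expressed through [al w], the
   integral of [gauss_cdf] over [x0, c w], and [be w], that of [1 - gauss_cdf]
   over [c w, x1]. *)
Definition stein_mean : R := (gauss_prim x1 - gauss_prim x0) / d.
Definition stein_step w : R := (x1 - c w) / d.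
Definition stein_sol w : R :=
  ((1 - gauss_cdf w) * al w + gauss_cdf w * be w) / d / gauss_pdf w.
Definition stein_sol' w : R := stein_step w - stein_mean + w * stein_sol w.

Lemma stein_step_ge w : ((w <= x0)%R)%:R <= stein_step w.
Proof.
have := c_itv w; have := d_gt0; rewrite /stein_step ler_pdivlMr// /d.
have [wx0|_] := leP w x0; last by rewrite mul0r; lra.
by rewrite mul1r; have := x01; case: (cP w) => -[+ ->]; lra.
Qed.

Lemma stein_step_le w : stein_step w <= ((w <= x1)%R)%:R.
Proof.
have := c_itv w; have := d_gt0; rewrite /stein_step ler_pdivrMr// /d.
have [wx0|] := leP w x1; first by rewrite mul1r; lra.
by rewrite mul0r; have := x01; case: (cP w) => -[+ ->]; lra.
Qed.

Lemma stein_step_lipschitz w w' : w <= w' ->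
  - ((w' - w) / d) <= stein_step w' - stein_step w <= 0.
Proof.
move=> /c_mono h; rewrite /stein_step -mulNr -mulrBl.
rewrite ler_pM2r ?invr_gt0// pmulr_lle0 ?invr_gt0//; lra.
Qed.

(** [stein_mean] is the average of [gauss_cdf] over [x0, x1], and the average of a Lipschitz
    function is within half the length times the constant of either endpoint value. Both endpoints
    serve: smoothing is done to the right and to the left of the given point. *)
Lemma stein_mean_close :
  `|stein_mean - gauss_cdf x0| <= d * (gauss_cst / 2) /\
  `|stein_mean - gauss_cdf x1| <= d * (gauss_cst / 2).
Proof.
have := gauss_prim_tangent (ltW x01) => /andP[t1 t2].
have u1 := gauss_prim_taylor x0 x1.
have u2 := gauss_prim_taylor x1 x0.
have k0 := @gauss_cst_gt0 R.
have E y : stein_mean - y = (gauss_prim x1 - gauss_prim x0 - y * d) / d.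
  by rewrite /stein_mean [RHS]mulrBl mulfK// gt_eqF.
have dk : 0 <= d * (gauss_cst / 2) * d by rewrite !mulr_ge0 ?invr_ge0 ?(ltW d_gt0) ?(ltW k0).
split; rewrite E ler_norml ler_pdivlMr// ler_pdivrMr//; apply/andP; split;
  rewrite ?mulNr; move: dk; rewrite /d; nra.
Qed.

Let kk w := gauss_prim (c w) - c w * gauss_cdf w.

(** The clamp has corners, but formally its derivative is multiplied by
    [gauss_cdf (c w) - gauss_cdf w], which vanishes where the clamp moves. The function [b] isolates
    this contribution and is bounded by the square of the increment. *)
Let is_derive_kk w : is_derive w 1 kk (- (c w * gauss_pdf w)).
Proof.
pose b w' := gauss_prim (c w') - gauss_prim (c w) - (c w' - c w) * gauss_cdf w'.
have db : is_derive w 1 b 0.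
  apply: (@is_derive1_quadratic _ _ _ 1) => y.
  have -> : b w = 0 by rewrite /b !subrr mul0r subrr.
  rewrite subr0 mul1r /b.
  have [wy|/ltW yw] := leP w y.
    have := c_mono wy; have [->|[h1 h2] /andP[cc _]] := c_between wy.
      by rewrite !subrr mul0r subrr normr0 sqr_ge0.
    rewrite subr_ge0 in cc; have /andP[t1 t2] := gauss_prim_tangent cc.
    have L := gauss_cdf_lip1 wy.
    have Fc := gauss_cdf_le h1; have Fc' := gauss_cdf_le h2.
    have cc' := le_trans h1 cc; have cy := le_trans cc h2.
    rewrite ler_norml; apply/andP; split; nra.
  have := c_mono yw; have [->|[h1 h2] /andP[cc _]] := c_between yw.
    by rewrite !subrr mul0r subrr normr0 sqr_ge0.
  rewrite subr_ge0 in cc; have /andP[t1 t2] := gauss_prim_tangent cc.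
  have L := gauss_cdf_lip1 yw.
  have Fc := gauss_cdf_le h1; have Fc' := gauss_cdf_le h2.
  rewrite ler_norml; apply/andP; split; nra.
have dc (a : R) : is_derive w 1 (fun=> a) 0 by exact: is_derive_cst.
have -> : kk = (fun y => b y + (gauss_prim (c w) - c w * gauss_cdf y)).
  by apply/funext => y; rewrite /kk /b; ring.
apply: (is_derive1_eq (is_derive1D db (is_derive1B (dc _) (is_derive1M (dc _)
  (is_derive_gauss_cdf w))))).
by rewrite /=; ring.
Qed.

Lemma is_derive_stein_sol w : is_derive w 1 stein_sol (stein_sol' w).
Proof.
have dc (a : R) : is_derive w 1 (fun=> a) 0 by exact: is_derive_cst.
have p0 := gauss_pdf_gt0 w.
(* By the reflection formula for [gauss_prim] the clamp survives only in [kk]. *)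
have -> : stein_sol = (fun y => (kk y + gauss_cdf y * (x1 - stein_mean * d)
    - gauss_prim x0) / d / gauss_pdf y).
  apply/funext => y; rewrite /stein_sol; congr (_ / _ / _).
  rewrite /al /be /kk /stein_mean divfK ?gt_eqF// !gauss_primN; ring.
apply: (is_derive1_eq (is_derive1_div _ (is_derive1_div _
  (is_derive1B (is_derive1D (is_derive_kk w)
    (is_derive1M (is_derive_gauss_cdf w) (dc _))) (dc _)) (dc _))
  (is_derive_gauss_pdf w))).
- by rewrite gt_eqF.
- by rewrite gt_eqF.
rewrite /stein_sol' /stein_sol /al /be /kk /stein_step /stein_mean /= !gauss_primN.
by field; rewrite !gt_eqF.
Qed.

Let al_ge0 w : 0 <= al w.
Proof. by rewrite subr_ge0 gauss_prim_le//; case/andP: (c_itv w). Qed.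

Let be_ge0 w : 0 <= be w.
Proof. by rewrite subr_ge0 gauss_prim_le// lerN2; case/andP: (c_itv w). Qed.

Let al_le w : al w <= gauss_prim w.
Proof.
have p0 := gauss_prim_ge0 x0; rewrite /al; case: (cP w) => -[h ->].
- by rewrite subrr gauss_prim_ge0.
- lra.
- by have := gauss_prim_le h; lra.
Qed.

Let be_le w : be w <= gauss_prim (- w).
Proof.
have p0 := gauss_prim_ge0 (- x1); rewrite /be; case: (cP w) => -[h ->].
- by move: h; rewrite -lerN2 => /gauss_prim_le; lra.
- lra.
- by rewrite subrr gauss_prim_ge0.
Qed.

Let al_le_cdf w : al w <= d * gauss_cdf w.
Proof.
have /andP[h0 h1] := c_itv w; have /andP[_] := gauss_prim_tangent h0.
rewrite -/(al w) => h; case: (cP w) => -[hw E].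
- by rewrite /al E subrr mulr_ge0 ?gauss_cdf_ge0// ltW.
- apply: (le_trans h); rewrite E ler_wpM2r ?gauss_cdf_ge0// /d; lra.
- apply: (le_trans h); rewrite E ler_wpM2l ?(ltW d_gt0)//; exact: gauss_cdf_le.
Qed.

Let be_le_cdf w : be w <= d * (1 - gauss_cdf w).
Proof.
have /andP[h0 h1] := c_itv w.
have h1' : - x1 <= - c w by rewrite lerN2.
have /andP[_] := gauss_prim_tangent h1'.
rewrite -/(be w) => h; rewrite -gauss_cdfN; case: (cP w) => -[hw E].
- apply: (le_trans h); rewrite E opprK [- x0 + x1]addrC ler_wpM2l ?(ltW d_gt0)//.
  by apply: gauss_cdf_le; rewrite lerN2.
- apply: (le_trans h); rewrite E ler_wpM2r ?gauss_cdf_ge0// /d; lra.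
- by rewrite /be E subrr mulr_ge0 ?gauss_cdf_ge0// ltW.
Qed.

(** The derivative is a difference of two terms which the tail bounds on [al] and [be] and the Mills
    inequality place in [0, 1]. The constant 2 is the one that produces E|2 - Q/a| later. *)
Lemma stein_sol'_le w : `|stein_sol' w| <= 2.
Proof.
have p0 := gauss_pdf_gt0 w.
have -> : stein_sol' w = (be w * gauss_prim w - al w * gauss_prim (- w)) / (d * gauss_pdf w).
  rewrite /stein_sol' /stein_sol /al /be /stein_step /stein_mean !gauss_primN /gauss_prim.
  by field; rewrite !gt_eqF.
have dp : 0 < d * gauss_pdf w by rewrite mulr_gt0.
have F0 := gauss_cdf_ge0 w; have F1 := gauss_cdf_le1 w.
have m1 := gauss_mills_upper w; have m2 := gauss_mills_upper (- w).
rewrite gauss_cdfN gauss_pdfN in m2.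
have hb0 : 0 <= be w * gauss_prim w by rewrite mulr_ge0 ?be_ge0 ?gauss_prim_ge0.
have ha0 : 0 <= al w * gauss_prim (- w) by rewrite mulr_ge0 ?al_ge0 ?gauss_prim_ge0.
have hb : be w * gauss_prim w <= d * gauss_pdf w.
  apply: le_trans (ler_wpM2r (gauss_prim_ge0 w) (be_le_cdf w)) _.
  by rewrite -mulrA ler_wpM2l ?(ltW d_gt0)// /gauss_prim; nra.
have ha : al w * gauss_prim (- w) <= d * gauss_pdf w.
  apply: le_trans (ler_wpM2r (gauss_prim_ge0 (- w)) (al_le_cdf w)) _.
  by rewrite -mulrA ler_wpM2l ?(ltW d_gt0)// /gauss_prim gauss_cdfN gauss_pdfN; nra.
by rewrite ler_norml ler_pdivlMr// ler_pdivrMr//; apply/andP; split; lra.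
Qed.

Let slope w := stein_sol w + w * stein_sol' w.

(** The slope of w f(w) is a combination of [al w] and [be w] with nonnegative coefficients.
    Replacing these by their upper bounds [gauss_prim w] and [gauss_prim (- w)] makes the
    combination exactly [gauss_pdf w]. *)
Let slope_itv w : 0 <= slope w <= d^-1.
Proof.
have p0 := gauss_pdf_gt0 w.
pose A := (1 + w ^+ 2) * (1 - gauss_cdf w) - w * gauss_pdf w.
pose B := (1 + w ^+ 2) * gauss_cdf w + w * gauss_pdf w.
have -> : slope w = (A * al w + B * be w) / (d * gauss_pdf w).
  rewrite /slope /stein_sol' /stein_sol /A /B /al /be /stein_step /stein_mean !gauss_primN.
  by field; rewrite !gt_eqF.
have A0 : 0 <= A.
  by have := gauss_mills_lower (- w); rewrite gauss_cdfN gauss_pdfN sqrrN /A; lra.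
have B0 : 0 <= B by have := gauss_mills_lower w; rewrite /B; lra.
have AB : A * gauss_prim w + B * gauss_prim (- w) = gauss_pdf w.
  by rewrite /A /B /gauss_prim gauss_cdfN gauss_pdfN; ring.
have dp : 0 < d * gauss_pdf w by rewrite mulr_gt0.
apply/andP; split.
  by rewrite divr_ge0 ?(ltW dp)// addr_ge0// mulr_ge0.
rewrite ler_pdivrMr// mulKf ?gt_eqF// -AB.
by rewrite lerD// ler_wpM2l.
Qed.

Let is_derive_slope w : is_derive w 1 (fun y => y * stein_sol y) (slope w).
Proof.
apply: (is_derive1_eq (is_derive1M (is_derive_id w 1) (is_derive_stein_sol w))).
by rewrite /slope /=; ring.
Qed.

(** The increment of the step lies in [-(y - x)/d, 0] and that of w f(w) in [0, (y - x)/d]; having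
    opposite signs, they do not accumulate. *)
Let stein_sol'_lipschitz x y : x <= y -> `|stein_sol' y - stein_sol' x| <= (y - x) / d.
Proof.
move=> xy; have := stein_step_lipschitz xy.
have [z _ E] := mean_value x y is_derive_slope.
have /andP[s0 s1] := slope_itv z.
have : 0 <= y * stein_sol y - x * stein_sol x <= (y - x) / d.
  rewrite E; apply/andP; split; first by rewrite mulr_ge0// subr_ge0.
  by rewrite mulrC ler_wpM2l// subr_ge0.
by rewrite /stein_sol' ler_norml; lra.
Qed.

(** [stein_sol'] has corners at [x0] and [x1]; a mean value and the Lipschitz bound take the place
    of a second derivative. *)
Lemma stein_sol_taylor x y :
  `|stein_sol y - stein_sol x - (y - x) * stein_sol' x| <= (y - x) ^+ 2 / d.
Proof.
have [z zxy ->] := mean_value x y is_derive_stein_sol.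
rewrite [(y - x) * _]mulrC -mulrBl normrM.
have zx : `|stein_sol' z - stein_sol' x| <= `|y - x| / d.
  case: zxy => /andP[h1 h2].
    apply: le_trans (stein_sol'_lipschitz h1) _.
    by rewrite ler_pM2r ?invr_gt0// ger0_norm; lra.
  rewrite distrC; apply: le_trans (stein_sol'_lipschitz h2) _.
  by rewrite ler_pM2r ?invr_gt0// ler0_norm; lra.
apply: le_trans (ler_wpM2r (normr_ge0 _) zx) _.
by rewrite mulrAC -expr2 real_normK ?num_real.
Qed.

Lemma stein_sol_continuous : continuous stein_sol.
Proof. exact: is_derive1_continuous is_derive_stein_sol. Qed.

Lemma stein_step_continuous : continuous stein_step.
Proof.
move=> w; apply: cvgM; last exact: cvg_cst.
apply: cvgB; first exact: cvg_cst.
apply/cvgrPdist_le => e e0; near=> w'.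
have : `|w - w'| <= e by near: w'; apply: cvgr_dist_le.
have [ww|/ltW ww] := leP w w'; have := c_mono ww; rewrite !ler_norml; lra.
Unshelve. all: by end_near. Qed.

Lemma stein_sol'_continuous : continuous stein_sol'.
Proof.
move=> x; apply: cvgD.
  by apply: cvgB; [exact: stein_step_continuous|exact: cvg_cst].
by apply: cvgM => //; exact: stein_sol_continuous.
Qed.

End SteinSolution.

(** * Stein's method for an abstract exchangeable pair *)

Section SteinInequality.
Context {R : realType} {T : ptopologicalType}.
Variable mu : probability (borelType T) R.
Hypothesis cT : compact [set: T].
Variables (W W' Q : T -> R) (a : R).
Hypotheses (cW : continuous W) (cW' : continuous W') (cQ : continuous Q).
Hypothesis a0 : 0 < a.
Hypothesis exch : forall u v : R -> R, continuous u -> continuous v ->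
  cint mu (fun x => u (W x) * v (W' x)) = cint mu (fun x => u (W' x) * v (W x)).
Hypothesis regr : forall f : R -> R, continuous f ->
  cint mu (fun x => W' x * f (W x)) = (1 - a) * cint mu (fun x => W x * f (W x)).
(** [Q] stands for the conditional mean of (W' - W)^2 given W. Only integrals against functions of W
    occur, so [Q] may be any function with the right integrals and no conditional expectation is
    constructed. *)
Hypothesis condvar : forall f : R -> R, continuous f ->
  cint mu (fun x => (W' x - W x) ^+ 2 * f (W x)) = cint mu (fun x => Q x * f (W x)).

(** Expanding the product, exchangeability pairs the terms into 2 E[W f(W)] - 2 E[W' f(W)]. This
    trades the term w f(w) of Stein's equation for increments of f. *)
Lemma exchangeable_regression (f : R -> R) : continuous f ->
  cint mu (fun x => (W' x - W x) * (f (W' x) - f (W x))) =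
  2 * a * cint mu (fun x => W x * f (W x)).
Proof.
move=> cf.
have cid : continuous (fun x : R => x) by move=> x; exact: cvg_id.
have c1 : continuous (fun _ : R => 1 : R) by exact: continuous_fun_cst.
have cfW : continuous (fun x => f (W x)) by exact: continuous_compf.
have cfW' : continuous (fun x => f (W' x)) by exact: continuous_compf.
have E1 : cint mu (fun x => W' x * f (W' x)) = cint mu (fun x => W x * f (W x)).
  have cu : continuous (fun w : R => w * f w) by cont.
  have := exch cu c1; under eq_fun do rewrite mulr1.
  by under [in RHS]eq_fun do rewrite mulr1.
have E2 := exch cid cf; have E3 := regr cf.
have -> : (fun x => (W' x - W x) * (f (W' x) - f (W x))) =
   (fun x => (W' x * f (W' x) - W' x * f (W x)) - (W x * f (W' x) - W x * f (W x))).
  by apply/funext => x; ring.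
rewrite !cintB//; [|by cont..].
rewrite E1 E2 E3; ring.
Qed.

(** Expanding the increment of f to first order turns E[W f(W)] into the mean of Q f'(W) / (2a) plus
    a remainder. What is left of f'(W) carries the factor 1 - Q/(2a); the remainder is cubic in W' -
    W. *)
Lemma stein_expectation (x0 x1 : R) : x0 < x1 ->
  `|cint mu (fun x => stein_step x0 x1 (W x)) - stein_mean x0 x1| <=
  2 * cint mu (fun x => `|1 - (2 * a)^-1 * Q x|) +
  (2 * a * (x1 - x0))^-1 * cint mu (fun x => `|W' x - W x| ^+ 3).
Proof.
move=> x01.
pose f := stein_sol x0 x1; pose f' := stein_sol' x0 x1; pose h := stein_step x0 x1.
have cf : continuous f by exact: stein_sol_continuous.
have cf' : continuous f' by exact: stein_sol'_continuous.
have ch : continuous h by exact: stein_step_continuous.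
have cfW : continuous (fun x => f (W x)) by exact: continuous_compf.
have cfW' : continuous (fun x => f (W' x)) by exact: continuous_compf.
have cf'W : continuous (fun x => f' (W x)) by exact: continuous_compf.
have chW : continuous (fun x => h (W x)) by exact: continuous_compf.
pose r x := f (W' x) - f (W x) - (W' x - W x) * f' (W x).
have cr : continuous r by rewrite /r; cont.
have d0 : 0 < x1 - x0 by rewrite subr_gt0.
have E : cint mu (fun x => h (W x)) - stein_mean x0 x1 =
    cint mu (fun x => (1 - (2 * a)^-1 * Q x) * f' (W x)) -
    (2 * a)^-1 * cint mu (fun x => (W' x - W x) * r x).
  have e1 : cint mu (fun x => h (W x)) - stein_mean x0 x1 =
      cint mu (fun x => f' (W x)) - cint mu (fun x => W x * f (W x)).
    rewrite -[stein_mean _ _](cint_cst mu) -!cintB//; [|by cont..].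
    by apply: eq_cint => x; rewrite /f' /stein_sol' -/f -/h; ring.
  have e2 := exchangeable_regression cf.
  have e3 : cint mu (fun x => (W' x - W x) * (f (W' x) - f (W x))) =
      cint mu (fun x => Q x * f' (W x)) + cint mu (fun x => (W' x - W x) * r x).
    rewrite -condvar// -cintD//; [|by cont..].
    by apply: eq_cint => x; rewrite /r; ring.
  have e4 : cint mu (fun x => (1 - (2 * a)^-1 * Q x) * f' (W x)) =
      cint mu (fun x => f' (W x)) - (2 * a)^-1 * cint mu (fun x => Q x * f' (W x)).
    rewrite -cintZ//; last by cont.
    rewrite -cintB//; [|by cont..].
    by apply: eq_cint => x; ring.
  rewrite e1 e4.
  have -> : cint mu (fun x => W x * f (W x)) = (2 * a)^-1 *
      (cint mu (fun x => Q x * f' (W x)) + cint mu (fun x => (W' x - W x) * r x)).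
    by rewrite -e3 e2 mulKf// gt_eqF// mulr_gt0.
  ring.
rewrite -/h E.
have cV : continuous (fun x => 1 - (2 * a)^-1 * Q x) by cont.
have cVf : continuous (fun x => (1 - (2 * a)^-1 * Q x) * f' (W x)) by cont.
have cD : continuous (fun x => W' x - W x) by cont.
have cDr : continuous (fun x => (W' x - W x) * r x) by cont.
apply: le_trans (ler_normB _ _) _; apply: lerD.
  apply: (le_trans (normr_cint mu cT cVf)).
  rewrite -cintZ//; last exact: continuous_fun_norm.
  apply: le_cint => //.
  - exact: continuous_fun_norm.
  - apply: continuous_funM; first exact: continuous_fun_cst.
    exact: continuous_fun_norm.
  - by move=> x; rewrite normrM mulrC ler_wpM2r// stein_sol'_le.
have a2 : 0 < (2 * a)^-1 by rewrite invr_gt0 mulr_gt0.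
rewrite normrM gtr0_norm// [(_ * (x1 - x0))^-1]invfM -mulrA ler_pM2l//.
apply: (le_trans (normr_cint mu cT cDr)).
have cD3 : continuous (fun x => `|W' x - W x| ^+ 3).
  by apply: continuous_funX; exact: continuous_fun_norm.
rewrite -cintZ//; apply: le_cint => //.
- exact: continuous_fun_norm.
- by apply: continuous_funM => //; exact: continuous_fun_cst.
move=> x; rewrite normrM exprS mulrCA ler_wpM2l// real_normK ?num_real// mulrC.
exact: stein_sol_taylor.
Qed.

(** The indicator lies between the steps descending over [x0 - d, x0] and over [x0, x0 + d]. *)
Lemma stein_kolmogorov (x0 d : R) : 0 < d ->
  `|fine (mu [set x | W x <= x0]) - gauss_cdf x0| <=
  d * (gauss_cst / 2) + (2 * cint mu (fun x => `|1 - (2 * a)^-1 * Q x|) +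
  (2 * a * d)^-1 * cint mu (fun x => `|W' x - W x| ^+ 3)).
Proof.
move=> d0.
have mA : measurable ([set x | W x <= x0] : set (borelType T)).
  apply: closed_borel_measurable.
  by apply: (closed_comp (f := W)) (@closed_le _ x0) => x _; exact: cW.
have indE (x : T) : \1_[set x | W x <= x0] x = ((W x <= x0)%R)%:R :> R.
  rewrite indicE; congr (nat_of_bool _)%:R.
  by apply/idP/idP; rewrite inE.
have xd : x0 < x0 + d by rewrite ltrDl.
have dx : x0 - d < x0 by rewrite ltrBlDr ltrDl.
have S1 := stein_expectation xd; have S2 := stein_expectation dx.
have [M1 _] := stein_mean_close xd; have [_ M2] := stein_mean_close dx.
rewrite [x0 + d - x0]addrAC subrr add0r in S1 M1.
rewrite opprB addrCA subrr addr0 in S2 M2.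
have U : fine (mu [set x | W x <= x0]) <= cint mu (fun x => stein_step x0 (x0 + d) (W x)).
  apply: cint_indic_le => //.
    by apply: continuous_compf => //; exact: stein_step_continuous.
  by move=> x; rewrite indE; exact: stein_step_ge.
have L : cint mu (fun x => stein_step (x0 - d) x0 (W x)) <= fine (mu [set x | W x <= x0]).
  apply: cint_indic_ge => //.
    by apply: continuous_compf => //; exact: stein_step_continuous.
  by move=> x; rewrite indE; exact: stein_step_le.
move: S1 S2 M1 M2 U L; rewrite !ler_norml.
set E := 2 * cint _ _ + _; set k := d * _.
move: (cint mu _) (cint mu _) (stein_mean _ _) (stein_mean _ _) => u1 u2 u3 u4.
move: (fine _) => u5; lra.
Qed.

End SteinInequality.

(** * The pair (chi(g), chi(g alpha)) *)

(** The constituents of tau^2 may have complex characters even though their sum W^2 is real. *)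
Definition rchar (R : realType) (G : topologicalGroupType)
  (rho : representation R G) (g : G) : R := complex.Re (character rho g).

Definition char_ratio (R : realType) (G : topologicalGroupType) (alpha : G)
  (rho : representation R G) : R := rchar rho alpha / (rdim rho)%:R.

Section CharacterPair.
Context {R : realType} {G : topologicalGroupType}.
Variable mu : probability (borelType G) R.
Hypothesis cG : compact [set: G].
Hypothesis scG : @second_countable G.
Hypothesis haar : is_haar mu.
Variables (tau : irrep R G) (alpha h : G).
Hypothesis tau_real : forall g : G, complex.Im (character tau g) = 0.
Hypothesis alpha_inv : (alpha^-1 = h^-1 * alpha * h)%g.

Local Notation ratio := (char_ratio alpha).

Let W := rchar tau.
Let W' (g : G) := W (g * alpha)%g.
Let a := 1 - ratio tau.

Let complex_ReM_real (z : R[i]) (r : R) :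
  complex.Re (z * (r%:C)%C) = complex.Re z * r.
Proof. by case: z => x y /=; ring. Qed.

Let c_rchar (rho : representation R G) : continuous (rchar rho).
Proof. by case: (ccontinuous_character rho). Qed.

Let cW : continuous W. Proof. exact: c_rchar. Qed.

Let cW' : continuous W'.
Proof. by apply: continuous_compf => //; exact: continuous_rmulg. Qed.

Let rchar_conj (rho : representation R G) g k : rchar rho (k^-1 * g * k)%g = rchar rho g.
Proof. by rewrite /rchar character_conj. Qed.

Let character_tau g : character tau g = (W g)%:C%C.
Proof. by rewrite /W /rchar; case: (character tau g) (tau_real g) => x y /= ->. Qed.

Let character_ratio (rho : representation R G) :
  character rho alpha / (rdim rho)%:R = (ratio rho)%:C%C.
Proof.
rewrite /char_ratio /rchar; have := Im_character_real cG scG haar rho alpha_inv.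
case: (character rho alpha) => x y /= ->.
by rewrite fmorph_div rmorph_nat.
Qed.

Lemma cint_rchar_mulr (phi : irrep R G) (F : G -> R) : continuous F ->
  (forall g k, F (k^-1 * g * k)%g = F g) ->
  cint mu (fun g => rchar phi (g * alpha)%g * F g) =
  ratio phi * cint mu (fun g => rchar phi g * F g).
Proof.
move=> cF Fc; have cFC := ccontinuous_real cF.
have := @cintC_character_mulr _ _ mu cG scG haar phi alpha (fun g => (F g)%:C%C) cFC.
rewrite character_ratio => /(_ (fun k g => congr1 (fun r => r%:C%C) (Fc g k))).
move/(congr1 (@complex.Re R)); rewrite mulrC complex_ReM_real mulrC !Re_cintC.
by under eq_fun do rewrite complex_ReM_real; under [in RHS]eq_fun do rewrite complex_ReM_real.
Qed.

(** Right translation by alpha carries the pair at g alpha^-1 and g to the pair at g and g alpha;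
    conjugation by [h] then turns alpha^-1 into alpha without changing W. *)
Lemma exchangeable_characters (u v : R -> R) : continuous u -> continuous v ->
  cint mu (fun g => u (W g) * v (W' g)) = cint mu (fun g => u (W' g) * v (W g)).
Proof.
move=> cu cv; pose K g := u (W (g * alpha^-1)%g) * v (W g).
have cK : continuous K.
  apply: continuous_funM; last exact: continuous_compf.
  apply: continuous_compf => //; apply: continuous_compf => //.
  exact: continuous_rmulg.
transitivity (cint mu K).
  rewrite -(cint_mulr cG scG haar alpha cK); apply: eq_cint => g.
  by rewrite /K mulgK.
rewrite -(cint_conj cG scG haar h cK); apply: eq_cint => g.
rewrite /K alpha_inv; congr (u _ * v _); last by rewrite /W rchar_conj.
by rewrite /W' -[RHS](rchar_conj tau (g * alpha)%g h) !mulgA mulgK.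
Qed.

Lemma cint_W_sqr : cint mu (fun g => W g ^+ 2) = 1.
Proof.
have := character_orthogonality cG scG haar tau tau.
rewrite irrep_iso_refl => /(congr1 (@complex.Re R)); rewrite Re_cintC /= => <-.
apply: eq_cint => g; rewrite character_tau /=; ring.
Qed.

Let regression (F : G -> R) : continuous F ->
  (forall g k, F (k^-1 * g * k)%g = F g) ->
  cint mu (fun g => W' g * F g) = (1 - a) * cint mu (fun g => W g * F g).
Proof. by move=> cF Fc; rewrite cint_rchar_mulr// /a opprB addrC subrK. Qed.

Variables (k : nat) (s : 'I_k -> irrep R G).
Hypothesis iso_s : rep_iso (tensor_rep tau tau) (dsum_rep s).

Let character_sum g : (W g ^+ 2)%:C%C = \sum_i character (s i) g.
Proof.
rewrite -character_dsum -(character_iso iso_s) character_tensor character_tau.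
by rewrite -expr2 -rmorphXn.
Qed.

Let W_sqr g : W g ^+ 2 = \sum_i rchar (s i) g.
Proof.
have /(congr1 (@complex.Re R)) /= -> := character_sum g.
by rewrite (big_morph (@complex.Re R) (id1 := 0) (op1 := +%R)) => [|[? ?] []|].
Qed.

Let cint_rchar_W_sqr i : cint mu (fun g => rchar (s i) g * W g ^+ 2) =
  \sum_j (irrep_iso (s i) (s j))%:R.
Proof.
have : cintC mu (fun g => character (s i) g * (W g ^+ 2)%:C%C) =
    \sum_j (irrep_iso (s i) (s j))%:R.
  under eq_bigr do rewrite -(character_orthogonality cG scG haar).
  rewrite -cintC_sum//; last first.
    move=> j; apply: ccontinuousM; first exact: ccontinuous_character.
    by apply: ccontinuous_conj; exact: ccontinuous_character.
  congr cintC; apply/funext => g; rewrite -mulr_sumr -rmorph_sum -character_sum.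
  by congr (_ * _); rewrite -[RHS]/(conjc _) conjc_real.
move/(congr1 (@complex.Re R)); rewrite Re_cintC.
under eq_fun do rewrite complex_ReM_real.
move=> ->; rewrite (big_morph (@complex.Re R) (id1 := 0) (op1 := +%R)) => [|[? ?] []|]//.
by apply: eq_bigr => j _; case: irrep_iso.
Qed.

(** Against class functions W'^2 acts as the sum of ratio_i chi_i and W W' as (1 - a) W^2, while W^2
    is the sum of the chi_i. The coefficient is thus ratio_i - 2 (1 - a) + 1. *)
Let Q g := \sum_i (2 * a - (1 - ratio (s i))) * rchar (s i) g.

Let cQ : continuous Q.
Proof.
apply: continuous_fun_sum => i; apply: continuous_funM; last exact: c_rchar.
exact: continuous_fun_cst.
Qed.

Let cint_sum (F : 'I_k -> G -> R) : (forall i, continuous (F i)) ->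
  cint mu (fun g => \sum_i F i g) = \sum_i cint mu (F i).
Proof.
move=> cF; elim: (index_enum _) => [|i r IH].
  by under eq_fun do rewrite big_nil; rewrite big_nil cint_cst.
under eq_fun do rewrite big_cons.
by rewrite big_cons cintD ?IH//; exact: continuous_fun_sum.
Qed.

Let conditional_sqr (F : G -> R) : continuous F ->
  (forall g x, F (x^-1 * g * x)%g = F g) ->
  cint mu (fun g => W' g ^+ 2 * F g) =
  \sum_i ratio (s i) * cint mu (fun g => rchar (s i) g * F g).
Proof.
move=> cF Fc; under eq_fun do rewrite /W' W_sqr mulr_suml.
rewrite cint_sum => [|i].
  by apply: eq_bigr => i _; rewrite cint_rchar_mulr.
apply: continuous_funM => //; apply: continuous_compf => //.
exact: continuous_rmulg.
Qed.

Let W_sqr_mul (F : G -> R) : continuous F ->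
  cint mu (fun g => W g ^+ 2 * F g) = \sum_i cint mu (fun g => rchar (s i) g * F g).
Proof.
move=> cF; under eq_fun do rewrite W_sqr mulr_suml.
by rewrite cint_sum// => i; exact: continuous_funM.
Qed.

Let conditional_variance (f : R -> R) : continuous f ->
  cint mu (fun g => (W' g - W g) ^+ 2 * f (W g)) = cint mu (fun g => Q g * f (W g)).
Proof.
move=> cf; pose F g := f (W g).
have cF : continuous F by exact: continuous_compf.
have cWF : continuous (fun g => W g * F g) by exact: continuous_funM.
have Fc g x : F (x^-1 * g * x)%g = F g by rewrite /F /W rchar_conj.
have WFc g x : W (x^-1 * g * x)%g * F (x^-1 * g * x)%g = W g * F g.
  by rewrite Fc /W rchar_conj.
have -> : (fun g => (W' g - W g) ^+ 2 * f (W g)) =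
    (fun g => (W' g ^+ 2 * F g - 2 * (W' g * (W g * F g))) + W g ^+ 2 * F g).
  by apply/funext => g; rewrite /F; ring.
rewrite cintD ?cintB ?cintZ//; [|by cont..].
rewrite conditional_sqr// regression//.
have -> : cint mu (fun g => W g * (W g * F g)) = cint mu (fun g => W g ^+ 2 * F g).
  by apply: eq_cint => g; ring.
rewrite W_sqr_mul//.
have -> : cint mu (fun g => Q g * f (W g)) =
    \sum_i (2 * a - (1 - ratio (s i))) * cint mu (fun g => rchar (s i) g * F g).
  under eq_fun do rewrite /Q mulr_suml.
  rewrite cint_sum => [|i].
    apply: eq_bigr => i _; rewrite -cintZ//; last exact: continuous_funM.
    by apply: eq_cint => g; rewrite mulrA.
  apply: continuous_funM => //; apply: continuous_funM => //.
  exact: continuous_fun_cst.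
rewrite !mulr_sumr -sumrB -big_split /=.
by apply: eq_bigr => i _; ring.
Qed.

Let id_continuous : continuous (fun x : R => x).
Proof. by move=> x; exact: cvg_id. Qed.

Let cst_continuous (c : R) : continuous (fun x : R => c).
Proof. exact: continuous_fun_cst. Qed.

Let X_continuous n : continuous (fun x : R => x ^+ n).
Proof. exact: continuous_funX. Qed.

Let cint_W'X n : cint mu (fun g => W' g ^+ n) = cint mu (fun g => W g ^+ n).
Proof.
have := exchangeable_characters (@X_continuous n) (@cst_continuous 1).
by under eq_fun do rewrite mulr1; under [in RHS]eq_fun do rewrite mulr1.
Qed.

Let WX_class n g x : W (x^-1 * g * x)%g ^+ n = W g ^+ n.
Proof. by rewrite /W rchar_conj. Qed.

Lemma second_moment : cint mu (fun g => (W' g - W g) ^+ 2) = 2 * a.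
Proof.
have -> : (fun g => (W' g - W g) ^+ 2) =
    (fun g => (W' g ^+ 2 - 2 * (W' g * W g)) + W g ^+ 2).
  by apply/funext => g; ring.
rewrite cintD ?cintB ?cintZ//; [|by cont..].
rewrite cint_W'X regression//; last by move=> g x; exact: (WX_class 1).
under [X in (1 - a) * cint mu X]eq_fun do rewrite -expr2.
rewrite cint_W_sqr; ring.
Qed.

Let E i j : R := (irrep_iso (s i) (s j))%:R.

(** Only E[W'^2 W^2] sees the individual ratios; both odd mixed moments equal (1 - a) E W^4. The
    coefficient 2 - 8 (1 - a) + 6 ratio_i is the stated one. *)
Lemma fourth_moment : cint mu (fun g => (W' g - W g) ^+ 4) =
  \sum_i \sum_j E i j * (8 * a - 6 * (1 - ratio (s i))).
Proof.
have -> : (fun g => (W' g - W g) ^+ 4) =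
    (fun g => W' g ^+ 4 + (- 4 * (W' g ^+ 3 * W g) + (6 * (W' g ^+ 2 * W g ^+ 2)
      + (- 4 * (W' g * W g ^+ 3) + W g ^+ 4)))).
  by apply/funext => g; ring.
rewrite !cintD ?cintZ//; [|by cont..].
have -> : cint mu (fun g => W' g ^+ 3 * W g) = cint mu (fun g => W' g * W g ^+ 3).
  rewrite -(exchangeable_characters (@X_continuous 3) id_continuous).
  by apply: eq_cint => g; rewrite mulrC.
have cWX n : continuous (fun g => W g ^+ n) by exact: continuous_funX.
rewrite cint_W'X regression// conditional_sqr//.
have -> : cint mu (fun g => W g * W g ^+ 3) = cint mu (fun g => W g ^+ 4).
  by apply: eq_cint => g; rewrite -exprS.
have -> : cint mu (fun g => W g ^+ 4) = \sum_i cint mu (fun g => rchar (s i) g * W g ^+ 2).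
  by rewrite -W_sqr_mul//; apply: eq_cint => g; ring.
rewrite !mulr_sumr -!big_split /=; apply: eq_bigr => i _.
by rewrite cint_rchar_W_sqr -mulr_suml -/(E i); ring.
Qed.

Let nontrivial i := ~~ irrep_iso (s i) trivial_irrep.

(** The trivial representation occurs in tau^2 with multiplicity E W^2 = 1. *)
Let trivial_count : \sum_(i | ~~ nontrivial i) 1 = 1 :> R.
Proof.
have := multiplicity_count cG scG haar trivial_irrep iso_s.
under eq_fun do rewrite character_tensor character_tau -rmorphM
  character_trivial conjc1 mulr1 -expr2.
rewrite cintC_real cint_W_sqr -(rmorph_nat (real_complex R)) => /complexI E1.
rewrite [RHS]E1 -sum1dep_card natr_sum.
by apply: eq_bigl => i; rewrite /nontrivial negbK.
Qed.

Lemma char_ratio_iso (rho sigma : representation R G) :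
  rep_iso rho sigma -> ratio rho = ratio sigma.
Proof.
move=> iso; rewrite /char_ratio /rchar (character_iso iso); congr (_ / _%:R).
apply/eqP; rewrite -(eqr_nat R[i]); apply/eqP.
by have := character_iso iso 1%g; rewrite /character !rmx1 !mxtrace1.
Qed.

Let e i := 2 - a^-1 * (1 - ratio (s i)).

Let e_iso i j : irrep_iso (s i) (s j) -> e i = e j.
Proof. by move=> /asboolP/char_ratio_iso; rewrite /e => ->. Qed.

Let ratio_trivial : ratio (@trivial_rep R G) = 1.
Proof. by rewrite /char_ratio /rchar character_trivial divr1. Qed.

(** The single trivial constituent has [e i = 2] and character 1, and so cancels the constant 2. *)
Let centered_Q g : a != 0 ->
  2 - a^-1 * Q g = - \sum_(i | nontrivial i) e i * rchar (s i) g.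
Proof.
move=> a0; have -> : a^-1 * Q g = \sum_i e i * rchar (s i) g.
  rewrite /Q mulr_sumr; apply: eq_bigr => i _; rewrite /e; by field.
rewrite (bigID nontrivial) /= opprD addrC -addrA.
rewrite [X in - X + 2](_ : _ = 2); first by rewrite addNr addr0.
transitivity (2 * \sum_(i | ~~ nontrivial i) (1 : R)); last first.
  by rewrite trivial_count mulr1.
rewrite mulr_sumr; apply: eq_bigr => i.
rewrite /nontrivial negbK => /asboolP iso; rewrite /e (char_ratio_iso iso) ratio_trivial.
by rewrite /rchar (character_iso iso) character_trivial subrr mulr0 subr0.
Qed.

(** The integrand is the squared real part of [Z]. Passing to the squared modulus avoids deciding
    whether [Z] is real and gives an integral that orthogonality evaluates. *)
Lemma variance_bound : a != 0 ->
  cint mu (fun g => (2 - a^-1 * Q g) ^+ 2) <=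
  \sum_(i | nontrivial i) \sum_j E i j * e i ^+ 2.
Proof.
move=> a0; pose Z g := \sum_(i | nontrivial i) (e i)%:C%C * character (s i) g.
have cZ : ccontinuous Z.
  apply: ccontinuous_sum => i; apply: ccontinuousM.
    exact: ccontinuous_cst.
  exact: ccontinuous_character.
have cZZ : ccontinuous (fun g => Z g * conjc (Z g)).
  by apply: ccontinuousM => //; exact: ccontinuous_conj.
have ReZ g : complex.Re (Z g) = \sum_(i | nontrivial i) e i * rchar (s i) g.
  rewrite (big_morph (@complex.Re R) (id1 := 0) (op1 := +%R)) => [|[? ?] []|]//.
  by apply: eq_bigr => i _; rewrite mulrC complex_ReM_real mulrC.
have -> : \sum_(i | nontrivial i) \sum_j E i j * e i ^+ 2 =
    cint mu (fun g => complex.Re (Z g * conjc (Z g))).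
  rewrite -Re_cintC.
  have -> : cintC mu (fun g => Z g * conjc (Z g)) =
      (\sum_(i | nontrivial i) \sum_(j | nontrivial j) E i j * (e i * e j))%:C%C.
    have -> : (fun g => Z g * conjc (Z g)) = (fun g =>
        \sum_(i | nontrivial i) \sum_(j | nontrivial j) ((e i * e j)%:C%C *
          (character (s i) g * conjc (character (s j) g)))).
      apply/funext => g; rewrite [conjc _]rmorph_sum big_distrlr /=.
      apply: eq_bigr => i _; apply: eq_bigr => j _.
      case: (character (s i) g) (character (s j) g) => p q [u v].
      by apply/eqP; rewrite eq_complex /=; apply/andP; split; apply/eqP; ring.
    have cij i j : ccontinuous (fun g => character (s i) g * conjc (character (s j) g)).
      apply: ccontinuousM; first exact: ccontinuous_character.
      by apply: ccontinuous_conj; exact: ccontinuous_character.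
    have cij' i j : ccontinuous (fun g => (e i * e j)%:C%C *
        (character (s i) g * conjc (character (s j) g))).
      by apply: ccontinuousM => //; exact: ccontinuous_cst.
    rewrite cintC_sum//; last by move=> i; exact: ccontinuous_sum.
    rewrite rmorph_sum; apply: eq_bigr => i _.
    rewrite cintC_sum// rmorph_sum; apply: eq_bigr => j _.
    rewrite cintCZ// character_orthogonality// [RHS]rmorphM mulrC; congr (_ * _).
    by rewrite /E; case: irrep_iso.
  rewrite /=; apply: eq_bigr => i ni; rewrite big_mkcond [RHS]big_mkcond /=.
  apply: eq_bigr => j _; rewrite /E.
  have [ij|_] := boolP (irrep_iso (s i) (s j)); last by rewrite !mul0r if_same.
  have -> : nontrivial j.
    by apply: contra ni => jt; exact: irrep_iso_trans ij jt.
  by rewrite -(e_iso ij) expr2.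
apply: le_cint => //.
- by cont.
- by case: cZZ.
move=> g; rewrite centered_Q// sqrrN -ReZ.
by case: (Z g) => x y /=; rewrite mulrN opprK expr2 lerDl -expr2 sqr_ge0.
Qed.

Lemma character_kolmogorov (x0 : R) : a != 0 ->
  `|fine (mu [set g | W g <= x0]) - gauss_cdf x0| <=
  Num.sqrt (\sum_(i | nontrivial i) \sum_j E i j * e i ^+ 2) +
  (trigo.pi^-1 * \sum_i \sum_j E i j * (8 - 6 / a * (1 - ratio (s i)))) `^ (4^-1).
Proof.
move=> a_neq0.
set S1 := \sum_(i | _) _; set S2 := \sum_i _.
have cD : continuous (fun g => W' g - W g) by cont.
(* The sign of [a] comes from 2a being a second moment. *)
have a0 : 0 < a.
  rewrite lt0r a_neq0 -(pmulr_rge0 _ (ltr0Sn R 1)) -second_moment.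
  by apply: cint_ge0 => g; exact: sqr_ge0.
have m4 : cint mu (fun g => (W' g - W g) ^+ 4) = a * S2.
  rewrite fourth_moment /S2 mulr_sumr; apply: eq_bigr => i _.
  rewrite mulr_sumr; apply: eq_bigr => j _; field; exact: a_neq0.
(* From (E D^2)^2 <= E D^4, that is, 4 a^2 <= a S2; it makes the smoothing length positive. *)
have S2_gt0 : 0 < S2.
  have c1 : continuous (fun _ : G => 1 : R) by exact: continuous_fun_cst.
  have cD2 : continuous (fun g => (W' g - W g) ^+ 2) by exact: continuous_funX.
  have := cint_cauchy_schwarz mu cG cD2 c1.
  under eq_fun do rewrite mulr1.
  rewrite second_moment; under [X in _ <= cint mu X * _]eq_fun do rewrite -exprM.
  rewrite m4 expr1n cint_cst mulr1 => h1.
  by rewrite -(pmulr_rgt0 _ a0) (lt_le_trans _ h1)// exprn_gt0// mulr_gt0.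
pose y := (trigo.pi^-1 * S2) `^ 4^-1.
have pi0 := pi_gt0 R.
have y0 : 0 < y by rewrite powR_gt0// mulr_gt0// invr_gt0.
have y4 : y ^+ 4 = S2 / trigo.pi.
  rewrite -powR_mulrn ?(ltW y0)// -powRrM mulVf// powRr1 1?mulrC//.
  by rewrite mulr_ge0 ?invr_ge0 ?ltW.
have k0 := @gauss_cst_gt0 R; have k2 : gauss_cst ^+ 2 * (2 * trigo.pi) = 1 :> R.
  by rewrite exprVn sqr_sqrtr ?mulr_ge0 ?ltW// mulVf// gt_eqF// mulr_gt0.
(* The optimal smoothing length: the smoothing error and the third-moment term are then both at most
   y / 2. *)
have d0 : 0 < y / gauss_cst by rewrite divr_gt0.
have cQ' : continuous (fun g => 2 - a^-1 * Q g) by cont.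
(* Cauchy-Schwarz for |D| and D^2; the right-hand side is sqrt(2a * a S2) rewritten through [y]. *)
have T3 : cint mu (fun g => `|W' g - W g| ^+ 3) <= a * y ^+ 2 / gauss_cst.
  have cN : continuous (fun g => `|W' g - W g|) by exact: continuous_fun_norm.
  have cD2 : continuous (fun g => (W' g - W g) ^+ 2) by exact: continuous_funX.
  have := cint_cauchy_schwarz mu cG cN cD2.
  have -> : (fun g => `|W' g - W g| * (W' g - W g) ^+ 2) = (fun g => `|W' g - W g| ^+ 3).
    by apply/funext => g; rewrite -[(_ - _) ^+ 2]real_normK ?num_real// -exprS.
  have -> : (fun g => `|W' g - W g| ^+ 2) = (fun g => (W' g - W g) ^+ 2).
    by apply/funext => g; rewrite real_normK ?num_real.
  under [X in _ <= _ * cint mu X]eq_fun do rewrite -exprM.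
  rewrite second_moment m4 => h1.
  rewrite -(@ler_pXn2r _ 2)// ?nnegrE; last 2 first.
  - by apply: cint_ge0 => g; exact: exprn_ge0.
  - by rewrite divr_ge0 ?(ltW k0)// mulr_ge0 ?exprn_ge0 ?(ltW a0) ?(ltW y0).
  apply: (le_trans h1); rewrite le_eqVlt; apply/orP; left; apply/eqP.
  rewrite expr_div_n exprMn -exprM y4.
  have -> : S2 / trigo.pi = 2 * S2 * gauss_cst ^+ 2.
    transitivity (S2 / trigo.pi * (gauss_cst ^+ 2 * (2 * trigo.pi))).
      by rewrite k2 mulr1.
    by move: (lt0r_neq0 pi0); generalize (@trigo.pi R) => p p0; field.
  field; rewrite gt_eqF//.
have V1 : 2 * cint mu (fun g => `|1 - (2 * a)^-1 * Q g|) <= Num.sqrt S1.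
  have cV : continuous (fun g => `|1 - (2 * a)^-1 * Q g|) by cont.
  rewrite -cintZ//.
  have -> : (fun g => 2 * `|1 - (2 * a)^-1 * Q g|) = (fun g => `|2 - a^-1 * Q g|).
    apply/funext => g; rewrite -[X in X * _](@ger0_norm R) // -normrM; congr `|_|.
    by field; exact: a_neq0.
  have cV' : continuous (fun g => `|2 - a^-1 * Q g|) by exact: continuous_fun_norm.
  rewrite -[leLHS]ger0_norm; last by apply: cint_ge0.
  rewrite -sqrtr_sqr ler_wsqrtr//; apply: le_trans (variance_bound a_neq0).
  have c1 : continuous (fun _ : G => 1 : R) by exact: continuous_fun_cst.
  have := cint_cauchy_schwarz mu cG cV' c1.
  under eq_fun do rewrite mulr1.
  rewrite expr1n cint_cst mulr1 => /le_trans; apply.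
  by under eq_fun do rewrite real_normK ?num_real//.
have regr (f : R -> R) : continuous f ->
    cint mu (fun x => W' x * f (W x)) = (1 - a) * cint mu (fun x => W x * f (W x)).
  move=> cf; apply: regression; first exact: continuous_compf.
  by move=> g x; rewrite /W rchar_conj.
apply: le_trans (stein_kolmogorov cG cW cW' cQ a0 exchangeable_characters
  regr conditional_variance x0 d0) _.
rewrite addrCA lerD//.
have : (2 * a * (y / gauss_cst))^-1 * cint mu (fun g => `|W' g - W g| ^+ 3) <= y / 2.
  rewrite ler_pdivrMl; last by apply: mulr_gt0 => //; apply: mulr_gt0.
  apply: (le_trans T3).
  by rewrite le_eqVlt; apply/orP; left; apply/eqP; field; rewrite gt_eqF.
have : y / gauss_cst * (gauss_cst / 2) = y / 2 by field; rewrite gt_eqF.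
move=> -> h1; rewrite -/y; lra.
Qed.

End CharacterPair.

Theorem theorem3p7 (R : realType) (G : lieGroupType R)
    (mu : probability (borelType G) R) (tau : irrep R G) (alpha : G) :
  compact [set: G] ->
  is_haar mu ->
  ~ rep_iso tau trivial_rep ->
  (forall g : G, complex.Im (character tau g) = 0) ->
  alpha <> 1%g ->
  (exists h : G, (alpha^-1 = h^-1 * alpha * h)%g) ->
  let a : R := 1 - complex.Re (character tau alpha) / (rdim tau)%:R in
  a <> 0 ->
  let W : G -> R := fun g => complex.Re (character tau g) in
  let m : irrClass R G -> R :=
    fun phi => (multiplicity (repr phi) (tensor_rep tau tau))%:R in
  let b : irrClass R G -> R := fun phi =>
    1 - complex.Re (character (repr phi) alpha) / (rdim (repr phi))%:R in
  forall x0 : R,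
    `| fine (mu [set g : borelType G | W g <= x0])
       - (Num.sqrt (2 * trigo.pi))^-1 *
         \int[lebesgue_measure]_(x in `]-oo, x0]) expR (- (x ^+ 2 / 2)) |
    <= Num.sqrt (\sum_(phi \in [set phi | phi != trivial_class])
         m phi ^+ 2 * (2 - a^-1 * b phi) ^+ 2)
       + (trigo.pi^-1 * \sum_(phi \in [set: irrClass R G])
           m phi ^+ 2 * (8 - 6 / a * b phi)) `^ (4^-1).
Proof.
move=> cG haar _ tau_real _ [h alpha_inv] a /eqP a0 W m b x0.
have scG := @lie_second_countable R G.
have [k [s iso_s]] := complete_reducibility cG haar (tensor_rep tau tau).
(* The character ratio depends only on the class, so the representative chosen by [repr] can be
   exchanged for the constituent [s i]. *)
have bE i : b (\pi_(irrClass R G) (s i))%qT = 1 - char_ratio alpha (s i).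
  rewrite /b; congr (1 - _); apply: char_ratio_iso.
  apply/asboolP; rewrite -/(irrep_iso _ _) irrep_iso_sym pi_irrepE eqxx //.
rewrite -[(Num.sqrt _)^-1]/(@gauss_cst R) -gauss_cdfE.
rewrite (fsum_multiplicity cG scG haar _ _ iso_s).
rewrite (_ : [set: irrClass R G] = [set phi | predT phi]); last exact/seteqP.
rewrite (fsum_multiplicity cG scG haar _ _ iso_s).
have := character_kolmogorov cG scG haar tau_real alpha_inv iso_s x0 a0.
congr (_ <= _ + _).
  congr Num.sqrt; apply: eq_big => [i|i _]; first by rewrite irrep_isoE.
  by apply: eq_bigr => j _; rewrite bE.
congr (_ `^ _); congr (_ * _); apply: eq_bigr => i _.
by apply: eq_bigr => j _; rewrite bE.
Qed.
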